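(* There is a universal constant $c>0$ such that the following holds for every $n\ge 2$ and every weight function $w$ on $\{1,\dots,n\}$. As operators on $L^2(S_n)$, $$\Delta_w\ \ge\ \frac{c\,\delta}{\operatorname{dmix} w}\cdot\frac{\min_i w_i^2}{w_{\mathrm{tot}}}\ \Delta_{K_n},$$ where the factor $\delta=\delta(w)$ (defined in the context) satisfies the following estimates: 1. $\delta\ge c\left(\dfrac{\min^* w_{ij}}{\max_i w_i}\right)^2$, where $\min^* w_{ij}=\min\{w_{ij}: w_{ij}>0\}$; 2. $\delta\ge c$ when $w$ comes from a regular graph; 3. it always holds that $\delta\ge \dfrac{1}{2\operatorname{dmix} w}$.
   Context: A weight function $w$ on $\{1,\dots,n\}$ assigns to each unordered pair $\{i,j\}$, $i\neq j$, a number $w_{ij}=w_{ji}\in[0,\infty)$. Put $w_i=\sum_{j\ne i}w_{ij}$ and $w_{\mathrm{tot}}=\sum_i w_i$; it is assumed that $w_i>0$ for all $i$. A graph $G$ on $\{1,\dots,n\}$ is identified with the weight function with $w_{ij}=1$ if $\{i,j\}$ is an edge and $w_{ij}=0$ otherwise; $w$ comes from a regular graph if it arises this way from a graph all of whose vertices have the same degree. An element $A=\sum_\sigma c_\sigma\sigma$ of the group algebra of the symmetric group $S_n$ over $\mathbb C$ acts on $L^2(S_n)$ by $(Af)(\tau)=\sum_\sigma c_\sigma f(\sigma\tau)$. For $i\ne j$ let $\nabla_{ij}=1-(ij)$, where $(ij)$ is the transposition, and let $\Delta_w=\sum_{i<j}w_{ij}\nabla_{ij}$ and $\Delta_{K_n}=\sum_{i<j}\nabla_{ij}$.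 For self-adjoint operators, $A\ge B$ means that $A-B$ is positive semidefinite. Let $p_t(i,j)$, $t=0,1,2,\dots$, be the $t$-step transition probabilities of the lazy discrete-time Markov chain on $\{1,\dots,n\}$ with one-step probabilities $p(i,j)=\frac{w_{ij}}{2w_i}$ for $i\neq j$ and $p(i,i)=\frac12$. Let $\pi(j)=w_j/w_{\mathrm{tot}}$. Define $$\operatorname{dmix} w=\min\{t:\ \forall i,j,\ p_t(i,j)>\tfrac34\pi(j)\}$$ ($=\infty$ if no such $t$ exists). Call $w$ connected if for all $i,j$ there is $t$ with $p_t(i,j)>0$. For connected $w$, $\delta$ is defined by $$\frac1\delta=\prod_{k=0}^{\lfloor\log_2 \operatorname{dmix} w\rfloor}\max_i\bigl(1+p_{2^k}(i,i)\bigr).$$ If $w$ is not connected then $\operatorname{dmix} w=\infty$, and by convention $1/\operatorname{dmix} w=0$ and $\delta=1$, so that the statement is trivial. *)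

(* Defs.v *)
From mathcomp Require Import all_boot all_order all_algebra all_fingroup.
From mathcomp Require Import complex boolp reals.

Set Implicit Arguments.
Unset Strict Implicit.
Unset Printing Implicit Defensive.

Import Order.TTheory GRing.Theory Num.Theory.
Local Open Scope ring_scope.

Section GroupAlgebra.
Variables (R : realType) (n : nat).

(* An element A = sum_s c_s s of the group algebra is its coefficient function
   s |-> c_s; vectors of L^2(S_n) are functions on S_n. *)
Definition group_alg := {ffun 'S_n -> R[i]}.
Definition L2 := {ffun 'S_n -> R[i]}.

Definition ga_basis (s : 'S_n) : group_alg := [ffun t => (t == s)%:R].

(* MathComp composes permutations left to right, so (t * s)%g is the
   composite "s after t", i.e. the usual product s t. *)
Definition ga_act (A : group_alg) (f : L2) : L2 :=
  [ffun t => \sum_(s : 'S_n) A s * f (t * s)%g].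

Definition L2_dot (f g : L2) : R[i] := \sum_(s : 'S_n) f s * (g s)^*.

Definition self_adjoint (A : L2 -> L2) : Prop :=
  forall f g : L2, L2_dot (A f) g = L2_dot f (A g).

(* In R[i], 0 <= z means that z is real and nonnegative. *)
Definition pos_semidef (A : L2 -> L2) : Prop :=
  self_adjoint A /\ forall f : L2, 0 <= L2_dot (A f) f.

Definition op_ge (A B : L2 -> L2) : Prop :=
  [/\ self_adjoint A, self_adjoint B & pos_semidef (fun f => A f - B f)].

Definition nabla (i j : 'I_n) : group_alg :=
  ga_basis 1%g - ga_basis (tperm i j).

Definition Delta (w : 'I_n -> 'I_n -> R) : group_alg :=
  \sum_(i < n) \sum_(j < n | (i < j)%N) (w i j)%:C%C *: nabla i j.

Definition Delta_K : group_alg :=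
  \sum_(i < n) \sum_(j < n | (i < j)%N) nabla i j.

End GroupAlgebra.

Section Weights.
Variables (R : realType) (n : nat) (w : 'I_n -> 'I_n -> R).

Definition wdeg (i : 'I_n) : R := \sum_(j < n | j != i) w i j.

Definition wtot : R := \sum_(i < n) wdeg i.

(* A weight is only defined on pairs of distinct points; setting w i i = 0
   gives each weight exactly one representation. *)
Definition is_weight : Prop :=
  [/\ forall i j, w i j = w j i,
      forall i, w i i = 0,
      forall i j, 0 <= w i j
    & forall i, 0 < wdeg i].

Definition from_regular_graph : Prop :=
  exists e : rel 'I_n,
    [/\ symmetric e, irreflexive e,
        exists d : nat, forall i, #|[set j | e i j]| = d
      & forall i j, w i j = (e i j)%:R].

(* The initial values of the iterated minima and maxima below are bounds for
   the families concerned, hence do not change the result. *)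
Definition min_wdeg_sq : R := \big[Num.min/wtot ^+ 2]_(i < n) wdeg i ^+ 2.

Definition max_wdeg : R := \big[Num.max/0]_(i < n) wdeg i.

Definition min_pos_weight : R :=
  \big[Num.min/wtot]_(i < n) \big[Num.min/wtot]_(j < n | 0 < w i j) w i j.

Definition lazy_mx : 'M[R]_n :=
  \matrix_(i, j) if i == j then 1 / 2 else w i j / (2 * wdeg i).

Definition trans_prob (t : nat) (i j : 'I_n) : R := (lazy_mx ^+ t) i j.

Definition stationary (j : 'I_n) : R := wdeg j / wtot.

Definition mixed (t : nat) : bool :=
  [forall i, forall j, 3 / 4 * stationary j < trans_prob t i j].

(* None stands for infinity. *)
Definition dmix : option nat :=
  match pselect (exists t, mixed t) with
  | left ex => Some (ex_minn ex)
  | right _ => None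
  end.

(* 1 / dmix, with 1 / infinity = 0 *)
Definition inv_dmix : R := if dmix is Some t then t%:R^-1 else 0.

Definition connected : Prop := forall i j, exists t, 0 < trans_prob t i j.

(* A connected w has dmix <> None, so the default 0 below is never used;
   trunc_log 2 is the floor of the binary logarithm. *)
Definition delta : R :=
  if `[< connected >] then
    (\prod_(0 <= k < (trunc_log 2 (odflt 0%N dmix)).+1)
       \big[Num.max/0]_(i < n) (1 + trans_prob (2 ^ k) i i))^-1
  else 1.

End Weights.

(* Main.v *)
(* The octopus inequality at a centre v states that, for nonnegative q and
   B_ij(f) = sum_t |f t - f (t (ij))|^2,
     sum_ij q_i q_j B_ij <= 2 (sum_i q_i) (sum_j q_j B_vj).
   With q = p_t(v, .), weighted by w_v and summed over v, reversibility turns it into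
   D_2t <= 2 D_t for D_t = sum_ij w_i p_t(i,j) B_ij. Taking 2^k between dmix and 2 dmix
   and p_t > (3/4) pi there compares Delta_w with Delta_{K_n}, even with delta = 1.

   For the octopus, one needs s + W >= 0 where s is the scalar
   sum_ij q_i q_j (1 + [i = j]) and W = sum_ij q_i q_j ([i <> j] (ij) - (vi) - (vj)).
   It suffices that W^2 <= s^2, and s^2 - W^2 is a quartic form in q whose symmetrized
   coefficients are, for each equality pattern of i, j, k, l, zero or a multiple of a
   projection in the group algebra of the permutations of v, i, j, k, l: the isotypic
   projection of the partition (2,2) of S_4, or, in the generic case, the difference
   Pi - D_ijkl of two nested projections, where Pi = (sum over the five 4-subsets K of
   D_K) / 2 and D_K is the (2,2)-projection of S_K.

   For delta, let u_t = p_2t(x,x) / pi(x). An escape bound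
   (h x - s)^2 <= T pi(h > s) E(h) for the Dirichlet form E yields a Nash inequality
   u^3 <= 8 T E when u >= 2 and a spectral gap 1/T, hence dmix = O(T) and
   u_t = O(sqrt(T/t)) up to time dmix; the product defining 1/delta is then
   O(T max pi^2). Geodesics give T = O((w_tot / min* w)^2), and T = O(n^2) for regular
   graphs because every vertex is adjacent to at most three vertices of a geodesic. *)
Require Import Defs.
From mathcomp Require Import all_boot all_order all_algebra all_fingroup.
From mathcomp Require Import complex boolp reals.
From mathcomp Require Import ring lra zify.

Set Implicit Arguments.
Unset Strict Implicit.
Unset Printing Implicit Defensive.

Import Order.TTheory GRing.Theory Num.Theory.
Local Open Scope ring_scope.

(** * The octopus inequality *)

(** Products of transpositions of indexed points, with integer coefficients: the group algebra
    identities become decidable by computation, whatever the ambient finite set. *)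
Definition word := seq (nat * nat).
Definition lincomb := seq (int * word).

Definition swap_index (a : nat) (p : nat * nat) : nat :=
  if a == p.1 then p.2 else if a == p.2 then p.1 else a.

Definition word_key (m : nat) (w : word) : seq nat :=
  [seq foldl swap_index a w | a <- iota 0 m].

Definition valid_word (m : nat) (w : word) : bool :=
  all (fun p => (p.1 < m)%N && (p.2 < m)%N) w.

(** Reversing a word inverts its permutation, so this is the product L* M, whose value at [f] is the
    inner product of L f and M f. *)
Definition gram (L M : lincomb) : lincomb :=
  [seq (x.1 * y.1, rev x.2 ++ y.2) | x <- L, y <- M].

Definition lscale (z : int) (L : lincomb) : lincomb :=
  [seq (z * x.1, x.2) | x <- L].

(* Terms are collected up to equality of the permutations or of their inverses,
   which is sound for an autocorrelation. *)
Fixpoint insert_term (m : nat) (z : int) (w : word)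
    (acc : seq (int * word * seq nat)) :=
  if acc is (z', w', k) :: acc' then
    if (word_key m w == k) || (word_key m (rev w) == k) then (z + z', w', k) :: acc'
    else (z', w', k) :: insert_term m z w acc'
  else [:: (z, w, word_key m w)].

Definition collect (m : nat) (L : lincomb) :=
  foldr (fun x acc => insert_term m x.1 x.2 acc) [::] L.

Definition vanishes (m : nat) (L : lincomb) : bool :=
  all (fun x => valid_word m x.2) L && all (fun x => x.1.1 == 0) (collect m L).

(* The operator W_ij = [i != j] (ij) - (vi) - (vj); index 0 stands for v. *)
Definition arm_pair (a b : nat) : lincomb :=
  [:: ((a != b)%:R, [:: (a, b)]); (-1, [:: (0, a)%N]); (-1, [:: (0, b)%N])].

(** The coefficient of q_a q_b q_c q_d in s^2 - W^2. *)
Definition defect (a b c d : nat) : lincomb :=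
  ((1 + (a == b)%:R) * (1 + (c == d)%:R), [::])
    :: lscale (-1) (gram (arm_pair a b) (arm_pair c d)).

(** As an autocorrelation, [defect] is unchanged by swapping within a pair or exchanging the pairs,
    so the three pairings symmetrize over all orders. *)
Definition sym_defect (a b c d : nat) : lincomb :=
  defect a b c d ++ defect a c b d ++ defect a d b c.

(* 3 (sum of the Klein group) - (sum of the alternating group) on 4 points, which is
   12 times the projection onto the isotypic component of the partition (2,2). *)
Definition klein_alt (p : seq nat) : lincomb :=
  let: (a, b, c, d) := (nth 0 p 0, nth 0 p 1, nth 0 p 2, nth 0 p 3)%N in
  (2, [::]) ::
  [seq (2, w) | w <- [:: [:: (a, b); (c, d)]; [:: (a, c); (b, d)]; [:: (a, d); (b, c)]]] ++
  [seq (-1, [:: (t.1.1, t.1.2); (t.1.2, t.2)]) | t <-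
     [:: (a, b, c); (a, c, b); (a, b, d); (a, d, b);
         (a, c, d); (a, d, c); (b, c, d); (b, d, c)]].

(* Half of sum_K E_K - 2 E_1234, where E_K is klein_alt on the 4-subset K of 0,..,4.
   Twelve times the difference of two nested projections, see the header. *)
Definition klein_alt5 : lincomb :=
  (3, [::]) ::
  [seq (1, [:: (0%N, t.1.1); (t.1.2, t.2)]) | t <-
     [:: (1, 2, 3); (1, 2, 4); (1, 3, 4); (2, 1, 3); (2, 1, 4); (2, 3, 4);
         (3, 1, 2); (3, 1, 4); (3, 2, 4); (4, 1, 2); (4, 1, 3); (4, 2, 3)]%N] ++
  [seq (-1, w) | w <-
     [:: [:: (1, 2); (3, 4)]; [:: (1, 3); (2, 4)]; [:: (1, 4); (2, 3)]]%N] ++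
  [seq (-1, [:: (0%N, a); (0%N, b)]) | a <- [:: 1; 2; 3; 4]%N, b <- rem a [:: 1; 2; 3; 4]%N].

(** If [Y] is 12 times a projection then Y* Y = 12 Y, so with the factor 12 the test says that [L]
    agrees with the positive element [Y]. For empty [Y] it says that [L] vanishes. *)
Definition square_cert (m : nat) (L Y : lincomb) : bool :=
  vanishes m (lscale 12 L ++ lscale (-1) (gram Y Y)).

(** * Soundness of the computation with words *)

Section Words.
Variables (R : realFieldType) (T : finType) (x0 : T) (pts : seq T).
Variable f : {perm T} -> R.
Hypothesis pts_uniq : uniq pts.
Local Notation m := (size pts).

Definition autocorr (s : {perm T}) : R := \sum_t f t * f (t * s)%g.

Lemma autocorrV s : autocorr s^-1%g = autocorr s.
Proof.
rewrite /autocorr (reindex_inj (mulIg s)) /=.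
by apply: eq_bigr => t _; rewrite mulgK mulrC.
Qed.

Lemma autocorr_shift s r : \sum_t f (t * s)%g * f (t * r)%g = autocorr (s^-1 * r)%g.
Proof.
rewrite /autocorr (reindex_inj (mulIg s^-1%g)) /=.
by apply: eq_bigr => t _; rewrite mulgKV mulgA.
Qed.

Definition word_perm (w : word) : {perm T} :=
  foldr (fun p s => tperm (nth x0 pts p.1) (nth x0 pts p.2) * s)%g 1%g w.

Lemma word_perm_cat w1 w2 : word_perm (w1 ++ w2) = (word_perm w1 * word_perm w2)%g.
Proof. by elim: w1 => [|p w1 IH] /=; rewrite ?mul1g // IH mulgA. Qed.

Lemma word_permV w : word_perm (rev w) = (word_perm w)^-1%g.
Proof.
elim: w => [|p w IH]; first by rewrite invg1.
by rewrite rev_cons -cats1 word_perm_cat IH /= mulg1 invMg tpermV.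
Qed.

Lemma word_perm_nth w a : valid_word m w -> (a < m)%N ->
  word_perm w (nth x0 pts a) = nth x0 pts (foldl swap_index a w).
Proof.
elim: w a => [|[b c] w IH] a /=; first by rewrite perm1.
case/andP=> /andP [bm cm] vw am; rewrite permM /swap_index /=.
have E d : (d < m)%N -> (nth x0 pts a == nth x0 pts d) = (a == d).
  by move=> dm; rewrite nth_uniq.
case: (eqVneq a b) => [->|ab]; first by rewrite tpermL IH.
case: (eqVneq a c) => [->|ac]; first by rewrite tpermR IH.
by rewrite tpermD ?IH // eq_sym E.
Qed.

Lemma word_perm_out w y : valid_word m w -> y \notin pts -> word_perm w y = y.
Proof.
elim: w => [|[b c] w IH] /=; first by rewrite perm1.
case/andP=> /andP [bm cm] vw yp; rewrite permM.
have E d : (d < m)%N -> nth x0 pts d != y.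
  by move=> dm; apply: contraNneq yp => <-; apply: mem_nth.
by rewrite tpermD ?IH // E.
Qed.

(** Valid words fix every point outside [pts], so agreement on the indices suffices. *)
Lemma word_perm_eq w1 w2 : valid_word m w1 -> valid_word m w2 ->
  word_key m w1 = word_key m w2 -> word_perm w1 = word_perm w2.
Proof.
move=> v1 v2 /eq_in_map K; apply/permP => y.
case: (boolP (y \in pts)) => yp; last by rewrite !word_perm_out.
rewrite -(nth_index x0 yp) !word_perm_nth ?index_mem // K //.
by rewrite mem_iota add0n index_mem yp.
Qed.

Lemma valid_rev w : valid_word m (rev w) = valid_word m w.
Proof. exact: all_rev. Qed.

Definition ev_corr (L : lincomb) : R :=
  \sum_(x <- L) x.1%:~R * autocorr (word_perm x.2).

Definition ev_op (L : lincomb) (t : {perm T}) : R :=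
  \sum_(x <- L) x.1%:~R * f (t * word_perm x.2)%g.

Lemma ev_corr_cat L M : ev_corr (L ++ M) = ev_corr L + ev_corr M.
Proof. exact: big_cat. Qed.

Lemma ev_corr_scale z L : ev_corr (lscale z L) = z%:~R * ev_corr L.
Proof.
rewrite /ev_corr big_map mulr_sumr; apply: eq_bigr => x _.
by rewrite /= intrM mulrA.
Qed.

Lemma ev_corr_gram L M : ev_corr (gram L M) = \sum_t ev_op L t * ev_op M t.
Proof.
rewrite /ev_corr big_allpairs_dep /=.
transitivity (\sum_(x <- L) \sum_(y <- M) \sum_t
   (x.1%:~R * f (t * word_perm x.2)%g) * (y.1%:~R * f (t * word_perm y.2)%g)).
  apply: eq_bigr => x _; apply: eq_bigr => y _.
  rewrite word_perm_cat word_permV -autocorr_shift mulr_sumr.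
  by apply: eq_bigr => t _; rewrite intrM; ring.
rewrite exchange_big /=.
transitivity (\sum_(y <- M) \sum_t \sum_(x <- L)
   (x.1%:~R * f (t * word_perm x.2)%g) * (y.1%:~R * f (t * word_perm y.2)%g)).
  by apply: eq_bigr => y _; rewrite exchange_big.
rewrite exchange_big /=; apply: eq_bigr => t _.
rewrite /ev_op mulr_sumr; apply: eq_bigr => y _.
by rewrite mulr_suml.
Qed.

Lemma ev_insert z w acc : valid_word m w ->
  all (fun x => (valid_word m x.1.2) && (x.2 == word_key m x.1.2)) acc ->
  all (fun x => (valid_word m x.1.2) && (x.2 == word_key m x.1.2))
      (insert_term m z w acc) /\
  \sum_(x <- insert_term m z w acc) x.1.1%:~R * autocorr (word_perm x.1.2) =
  z%:~R * autocorr (word_perm w) +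
  \sum_(x <- acc) x.1.1%:~R * autocorr (word_perm x.1.2).
Proof.
move=> vw; elim: acc => [_|[[z' w'] k] acc IH] /=.
  by rewrite vw eqxx big_seq1 big_nil addr0.
case/andP=> /andP [vw' /eqP kE] va.
have [IHa IHs] := IH va; case: ifP => [|_] /=; last first.
  by rewrite vw' kE eqxx IHa !big_cons IHs; split => //; ring.
rewrite vw' va kE eqxx => /orP K; split=> //; rewrite !big_cons /= intrD.
suff -> : autocorr (word_perm w) = autocorr (word_perm w') by ring.
case: K => /eqP K; first by rewrite (word_perm_eq vw vw' K).
by rewrite -autocorrV -word_permV; congr autocorr; apply: word_perm_eq; rewrite ?valid_rev.
Qed.

Lemma ev_vanishes L : vanishes m L -> ev_corr L = 0.
Proof.
case/andP=> vL zL.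
have [_ E] : all (fun x => (valid_word m x.1.2) && (x.2 == word_key m x.1.2))
      (collect m L) /\
  \sum_(x <- collect m L) x.1.1%:~R * autocorr (word_perm x.1.2) = ev_corr L.
  rewrite /ev_corr; elim: L vL {zL} => [|[z w] L IH] /=; first by rewrite !big_nil.
  case/andP=> vw /IH [a E]; have [a' E'] := ev_insert z vw a.
  by rewrite a' E' big_cons E.
rewrite -E big_seq big1 // => x xL.
by rewrite (eqP (allP zL _ xL)) mul0r.
Qed.

Lemma square_cert_ge0 L Y : square_cert m L Y -> 0 <= ev_corr L.
Proof.
move=> /ev_vanishes; rewrite ev_corr_cat !ev_corr_scale ev_corr_gram => E.
have: 0 <= \sum_t ev_op Y t * ev_op Y t by apply: sumr_ge0 => t _; rewrite -expr2 sqr_ge0.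
move: E; set X := \sum_t _; set Z := ev_corr L; lra.
Qed.

End Words.

(** * From the certificates to the octopus inequality *)

Section Octopus.
Variables (R : realFieldType) (T : finType) (v : T) (f : {perm T} -> R).

Local Notation norm2 := (\sum_t f t * f t).

Definition arm_op (i j : T) (t : {perm T}) : R :=
  (i != j)%:R * f (t * tperm i j)%g - f (t * tperm v i)%g - f (t * tperm v j)%g.

Definition arm_defect (i j k l : T) : R :=
  (1 + (i == j)%:R) * (1 + (k == l)%:R) * norm2
  - \sum_t arm_op i j t * arm_op k l t.

Section Pattern.
Variables (pts : seq T).
Local Notation pt a := (nth v (v :: pts) a).

Lemma ev_arm_pair a b t : uniq (v :: pts) -> valid_word (size (v :: pts)) [:: (a, b)] ->
  ev_op v (v :: pts) f (arm_pair a b) t = arm_op (pt a) (pt b) t.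
Proof.
move=> u /= /andP [/andP [am bm] _].
rewrite /ev_op /arm_pair !big_cons big_nil /= !mulg1 /arm_op nth_uniq //.
by case: eqP => _ /=; ring.
Qed.

Lemma ev_defect a b c d : uniq (v :: pts) ->
    valid_word (size (v :: pts)) [:: (a, b); (c, d)] ->
  ev_corr v (v :: pts) f (defect a b c d) = arm_defect (pt a) (pt b) (pt c) (pt d).
Proof.
move=> u vv; have := vv; rewrite /= => /andP [/andP [am bm] /andP [/andP [cm dm] _]].
rewrite /defect /ev_corr big_cons -/(ev_corr v (v :: pts) f _).
rewrite ev_corr_scale ev_corr_gram /= /autocorr /arm_defect !nth_uniq //.
congr (_ + _).
  rewrite intrM !intrD; congr (_ * _).
    by do 2 case: eqP => _ //=.
  by apply: eq_bigr => t _; rewrite mulg1.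
rewrite mulN1r; congr (- _); apply: eq_bigr => t _.
by rewrite !ev_arm_pair //= ?am ?bm ?cm ?dm.
Qed.

Lemma ev_sym_defect_ge0 a b c d Y : uniq (v :: pts) ->
    valid_word (size (v :: pts)) [:: (a, b); (c, d)] ->
    square_cert (size (v :: pts)) (sym_defect a b c d) Y ->
  0 <= arm_defect (pt a) (pt b) (pt c) (pt d) +
       arm_defect (pt a) (pt c) (pt b) (pt d) +
       arm_defect (pt a) (pt d) (pt b) (pt c).
Proof.
move=> u vv /(@square_cert_ge0 R T v (v :: pts) f u).
have := vv; rewrite /= => /andP [/andP [am bm] /andP [/andP [cm dm] _]].
by rewrite /sym_defect !ev_corr_cat !ev_defect ?addrA //= ?am ?bm ?cm ?dm.
Qed.

End Pattern.

(** There are 15 equality patterns. The form is zero when three indices coincide or when they form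
    two pairs, [K] when exactly one pair coincides, and [klein_alt5] when all are distinct. *)
Lemma sym_defect_ge0 i j k l : i != v -> j != v -> k != v -> l != v ->
  0 <= arm_defect i j k l + arm_defect i k j l + arm_defect i l j k.
Proof.
move=> iv jv kv lv.
pose K := klein_alt [:: 0; 1; 2; 3]%N.
(** [pts] lists the distinct values; [a], [b], [c], [d] are positions in [v :: pts]. *)
Local Ltac pattern_case pts a b c d Y :=
  apply: (@ev_sym_defect_ge0 pts a b c d Y); last (by vm_compute); last (by []);
  rewrite /= !inE ?negb_or ?[v == _]eq_sym;
  repeat match goal with H : is_true (_ != _) |- _ => rewrite ?H; clear H end; done.
case: (eqVneq i j) => [<-|ij]; case: (eqVneq i k) => [<-|ik];
  case: (eqVneq i l) => [<-|il].
- pattern_case [:: i] 1%N 1%N 1%N 1%N ([::] : lincomb).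
- pattern_case [:: i; l] 1%N 1%N 1%N 2%N ([::] : lincomb).
- pattern_case [:: i; k] 1%N 1%N 2%N 1%N ([::] : lincomb).
- case: (eqVneq k l) => [<-|kl].
  + pattern_case [:: i; k] 1%N 1%N 2%N 2%N ([::] : lincomb).
  + pattern_case [:: i; k; l] 1%N 1%N 2%N 3%N K.
- pattern_case [:: i; j] 1%N 2%N 1%N 1%N ([::] : lincomb).
- case: (eqVneq j l) => [<-|jl].
  + pattern_case [:: i; j] 1%N 2%N 1%N 2%N ([::] : lincomb).
  + pattern_case [:: i; j; l] 1%N 2%N 1%N 3%N K.
- case: (eqVneq j k) => [<-|jk].
  + pattern_case [:: i; j] 1%N 2%N 2%N 1%N ([::] : lincomb).
  + pattern_case [:: i; j; k] 1%N 2%N 3%N 1%N K.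
- case: (eqVneq j k) => [<-|jk]; case: (eqVneq j l) => [<-|jl].
  + pattern_case [:: i; j] 1%N 2%N 2%N 2%N ([::] : lincomb).
  + pattern_case [:: i; j; l] 1%N 2%N 2%N 3%N K.
  + pattern_case [:: i; j; k] 1%N 2%N 3%N 2%N K.
  + case: (eqVneq k l) => [<-|kl].
    * pattern_case [:: i; j; k] 1%N 2%N 3%N 3%N K.
    * pattern_case [:: i; j; k; l] 1%N 2%N 3%N 4%N klein_alt5.
Qed.

Definition quad_sum (q : T -> R) (g : T -> T -> T -> T -> R) : R :=
  \sum_i \sum_j \sum_k \sum_l q i * q j * q k * q l * g i j k l.

Lemma quad_sumC23 q g : quad_sum q g = quad_sum q (fun i j k l => g i k j l).
Proof.
apply: eq_bigr => i _; rewrite exchange_big; apply: eq_bigr => j _.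
by apply: eq_bigr => k _; apply: eq_bigr => l _; rewrite (mulrAC _ (q k)).
Qed.

Lemma quad_sumC34 q g : quad_sum q g = quad_sum q (fun i j k l => g i j l k).
Proof.
apply: eq_bigr => i _; apply: eq_bigr => j _; rewrite exchange_big.
by apply: eq_bigr => k _; apply: eq_bigr => l _; rewrite (mulrAC _ (q l)).
Qed.

Lemma quad_sumD q g h :
  quad_sum q g + quad_sum q h = quad_sum q (fun i j k l => g i j k l + h i j k l).
Proof.
rewrite /quad_sum -big_split; apply: eq_bigr => i _; rewrite -big_split.
apply: eq_bigr => j _; rewrite -big_split; apply: eq_bigr => k _; rewrite -big_split.
by apply: eq_bigr => l _; rewrite mulrDr.
Qed.

Lemma quad_sumM q a b :
  quad_sum q (fun i j k l => a i j * b k l) =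
  (\sum_i \sum_j q i * q j * a i j) * (\sum_i \sum_j q i * q j * b i j).
Proof.
rewrite mulr_suml; apply: eq_bigr => i _; rewrite mulr_suml.
apply: eq_bigr => j _; rewrite mulr_sumr; apply: eq_bigr => k _.
by rewrite mulr_sumr; apply: eq_bigr => l _; ring.
Qed.

(** Permuting summation indices turns three copies of the sum into one of symmetrized coefficients;
    terms with an index [v] vanish with [q v]. *)
Lemma quad_sum_defect_ge0 q : (forall i, 0 <= q i) -> q v = 0 ->
  0 <= quad_sum q arm_defect.
Proof.
move=> q0 qv.
suff: 0 <= quad_sum q arm_defect + quad_sum q arm_defect + quad_sum q arm_defect by lra.
rewrite {3}quad_sumC23 (quad_sumC34 q (fun i j k l => arm_defect i k j l)) {2}quad_sumC23.
rewrite !quad_sumD.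
apply: sumr_ge0 => i _; apply: sumr_ge0 => j _.
apply: sumr_ge0 => k _; apply: sumr_ge0 => l _.
have [->|iv] := eqVneq i v; first by rewrite qv !mul0r.
have [->|jv] := eqVneq j v; first by rewrite qv mulr0 !mul0r.
have [->|kv] := eqVneq k v; first by rewrite qv mulr0 !mul0r.
have [->|lv] := eqVneq l v; first by rewrite qv mulr0 !mul0r.
by apply: mulr_ge0; [rewrite !mulr_ge0 | apply: sym_defect_ge0].
Qed.

Lemma quad_sum_armE q :
  quad_sum q arm_defect =
  (\sum_i \sum_j q i * q j * (1 + (i == j)%:R)) ^+ 2 * norm2 -
  \sum_t (\sum_i \sum_j q i * q j * arm_op i j t) ^+ 2.
Proof.
rewrite expr2 -quad_sumM.
under [X in _ - X]eq_bigr => t _ do rewrite expr2 -quad_sumM.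
have -> : \sum_t quad_sum q (fun i j k l => arm_op i j t * arm_op k l t) =
  quad_sum q (fun i j k l => \sum_t arm_op i j t * arm_op k l t).
  rewrite exchange_big; apply: eq_bigr => i _.
  rewrite exchange_big; apply: eq_bigr => j _.
  rewrite exchange_big; apply: eq_bigr => k _.
  by rewrite exchange_big; apply: eq_bigr => l _; rewrite mulr_sumr.
rewrite /quad_sum mulr_suml -sumrB; apply: eq_bigr => i _.
rewrite mulr_suml -sumrB; apply: eq_bigr => j _.
rewrite mulr_suml -sumrB; apply: eq_bigr => k _.
rewrite mulr_suml -sumrB; apply: eq_bigr => l _.
by rewrite /arm_defect; ring.
Qed.

Definition swap_energy (i j : T) : R := \sum_t (f t - f (t * tperm i j)%g) ^+ 2.

Lemma swap_energyE i j :
  swap_energy i j = 2 * norm2 - 2 * \sum_t f t * f (t * tperm i j)%g.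
Proof.
transitivity (norm2 + \sum_t f (t * tperm i j)%g * f (t * tperm i j)%g
              - 2 * \sum_t f t * f (t * tperm i j)%g).
  rewrite mulr_sumr -big_split -sumrB; apply: eq_bigr => t _ /=. ring.
have <- : norm2 = \sum_t f (t * tperm i j)%g * f (t * tperm i j)%g.
  exact: (reindex_inj (mulIg (tperm i j))).
by ring.
Qed.

(* 2 s (s + w) = (s + w)^2 + (s^2 - w^2) *)
Lemma scalar_dominates (s : R) (w : {perm T} -> R) :
  0 <= s ^+ 2 * norm2 - \sum_t w t ^+ 2 -> 0 <= s * (s * norm2 + \sum_t f t * w t).
Proof.
have : 0 <= \sum_t (s * f t + w t) ^+ 2 by apply: sumr_ge0 => t _; apply: sqr_ge0.
have -> : \sum_t (s * f t + w t) ^+ 2 =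
   s ^+ 2 * norm2 + 2 * s * (\sum_t f t * w t) + \sum_t w t ^+ 2.
  by rewrite !mulr_sumr -!big_split; apply: eq_bigr => t _ /=; ring.
set X := \sum_t w t ^+ 2; set Y := \sum_t f t * w t; set Z := norm2; lra.
Qed.

Lemma double_weighted_sum (q e : T -> R) :
  2 * (\sum_i q i) * (\sum_i q i * e i) = \sum_i \sum_j q i * q j * (e i + e j).
Proof.
transitivity ((\sum_i q i) * (\sum_i q i * e i) + (\sum_i q i * e i) * (\sum_i q i)).
  by ring.
rewrite !mulr_suml -big_split; apply: eq_bigr => i _ /=.
by rewrite !mulr_sumr -big_split; apply: eq_bigr => j _ /=; ring.
Qed.

Lemma octopus_centred (q : T -> R) : (forall i, 0 <= q i) -> q v = 0 ->
  \sum_i \sum_j q i * q j * swap_energy i j <=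
  2 * (\sum_i q i) * \sum_i q i * swap_energy v i.
Proof.
move=> q0 qv.
set s := \sum_i \sum_j q i * q j * (1 + (i == j)%:R).
pose w t := \sum_i \sum_j q i * q j * arm_op i j t.
have D : 0 <= s ^+ 2 * norm2 - \sum_t w t ^+ 2.
  by rewrite -quad_sum_armE quad_sum_defect_ge0.
have s0 : 0 <= s.
  by apply: sumr_ge0 => i _; apply: sumr_ge0 => j _; rewrite !mulr_ge0 // addr_ge0.
have N := scalar_dominates D.
(* The two sides differ by 2 <f, (s + W) f>. *)
have E : 2 * (\sum_i q i) * (\sum_i q i * swap_energy v i) -
   \sum_i \sum_j q i * q j * swap_energy i j = 2 * (s * norm2 + \sum_t f t * w t).
  have -> : 2 * (\sum_i q i) * (\sum_i q i * swap_energy v i) =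
     \sum_i \sum_j q i * q j * (swap_energy v i + swap_energy v j) by exact: double_weighted_sum.
  have -> : \sum_t f t * w t = \sum_i \sum_j q i * q j * \sum_t f t * arm_op i j t.
    under eq_bigr => t _ do rewrite mulr_sumr.
    rewrite exchange_big; apply: eq_bigr => i _.
    under eq_bigr => t _ do rewrite mulr_sumr.
    rewrite exchange_big; apply: eq_bigr => j _.
    by rewrite mulr_sumr; apply: eq_bigr => t _; ring.
  rewrite /s mulr_suml -big_split mulr_sumr -sumrB; apply: eq_bigr => i _ /=.
  rewrite mulr_suml -big_split mulr_sumr -sumrB; apply: eq_bigr => j _ /=.
  have -> : \sum_t f t * arm_op i j t = (i != j)%:R * \sum_t f t * f (t * tperm i j)%g
     - \sum_t f t * f (t * tperm v i)%g - \sum_t f t * f (t * tperm v j)%g.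
    by rewrite mulr_sumr -!sumrB; apply: eq_bigr => t _; rewrite /arm_op; ring.
  rewrite !swap_energyE; case: (eqVneq i j) => [<-|ij] /=; last by ring.
  have -> : \sum_t f t * f (t * tperm i i)%g = norm2; last by ring.
  by apply: eq_bigr => t _; rewrite tperm1 mulg1.
rewrite -subr_ge0 E mulr_ge0 //.
(* For s > 0 the factor [s] in [N] cancels; otherwise (sum q)^2 <= s forces q = 0. *)
have [s1|s1] := ltP 0 s; first by rewrite pmulr_rge0 in N.
have /eqP q_sum0 : \sum_i q i == 0.
  rewrite -sqrf_eq0 eq_le sqr_ge0 andbT (le_trans _ s1) // expr2 mulr_suml.
  apply: ler_sum => i _; rewrite mulr_sumr; apply: ler_sum => j _.
  by rewrite ler_peMr ?mulr_ge0 // lerDl.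
have q_eq0 i : q i = 0 by apply: (psumr_eq0P _ q_sum0).
rewrite (le_anti (introT andP (conj s1 s0))) mul0r add0r sumr_ge0 // => t _.
by rewrite /w big1 ?mulr0 // => i _; rewrite big1 // => j _; rewrite q_eq0 !mul0r.
Qed.

(** Mass of [q] at the centre [v] adds the same term, 2 q(v) sum_i q'(i) B_vi, to both sides of the
    centred case. *)
Lemma octopus (q : T -> R) : (forall i, 0 <= q i) ->
  \sum_i \sum_j q i * q j * swap_energy i j <=
  2 * (\sum_i q i) * \sum_i q i * swap_energy v i.
Proof.
move=> q0; pose q' i := if i == v then 0 else q i.
have q'0 i : 0 <= q' i by rewrite /q'; case: eqP.
have q'v : q' v = 0 by rewrite /q' eqxx.
have qE i : q i = q' i + (i == v)%:R * q v.
  by rewrite /q'; case: eqP => [->|_]; rewrite ?mul1r ?mul0r ?add0r ?addr0.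
have split (F : T -> R) : \sum_i q i * F i = \sum_i q' i * F i + q v * F v.
  rewrite (bigD1 v) //= [X in _ = X + _](bigD1 v) //= q'v mul0r add0r addrC.
  by congr (_ + _); apply: eq_bigr => i iv; rewrite qE (negPf iv) mul0r addr0.
have vv : swap_energy v v = 0.
  rewrite /swap_energy big1 // => t _.
  by rewrite tperm1 mulg1 subrr expr0n.
have sC i j : swap_energy i j = swap_energy j i by rewrite /swap_energy tpermC.
have S1 : \sum_i q i = \sum_i q' i + q v.
  by have := split (fun=> 1); rewrite mulr1; under eq_bigr do rewrite mulr1;
     under [X in _ = X + _]eq_bigr do rewrite mulr1.
have S2 : \sum_i q i * swap_energy v i = \sum_i q' i * swap_energy v i.
  by rewrite split vv mulr0 addr0.
have S3 : \sum_i \sum_j q i * q j * swap_energy i j =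
  \sum_i \sum_j q' i * q' j * swap_energy i j
  + 2 * q v * \sum_i q' i * swap_energy v i.
  under eq_bigr => i _ do (under eq_bigr => j _ do rewrite -mulrA; rewrite -mulr_sumr).
  rewrite split S2 [X in X + _](_ : _ =
    \sum_i \sum_j q' i * q' j * swap_energy i j + q v * \sum_i q' i * swap_energy v i).
    by ring.
  rewrite mulr_sumr -big_split; apply: eq_bigr => i _ /=.
  rewrite split mulrDr mulr_sumr (sC i v); congr (_ + _); last by ring.
  by apply: eq_bigr => j _; ring.
have := octopus_centred q'0 q'v; rewrite S1 S2 S3; lra.
Qed.

End Octopus.

(** * The group algebra acting on L2 *)

Section Operators.
Variables (R : realType) (n : nat).
Implicit Types (b : 'I_n -> 'I_n -> R) (f g : L2 R n).

Lemma ga_act_Delta b f t :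
  ga_act (Delta b) f t =
  \sum_(i < n) \sum_(j < n | (i < j)%N) (b i j)%:C%C * (f t - f (t * tperm i j)%g).
Proof.
rewrite ffunE; under eq_bigr => s _ do rewrite /Delta sum_ffunE mulr_suml.
rewrite exchange_big; apply: eq_bigr => i _ /=.
under eq_bigr => s _ do rewrite sum_ffunE mulr_suml.
rewrite exchange_big; apply: eq_bigr => j _ /=.
have delta_sum (r : 'S_n) : \sum_s (s == r)%:R * f (t * s)%g = f (t * r)%g.
  rewrite (bigD1 r) //= eqxx mul1r big1 ?addr0 // => s sr.
  by rewrite (negPf sr) mul0r.
transitivity ((b i j)%:C%C * (\sum_(s : 'S_n) (s == 1%g)%:R * f (t * s)%g
    - \sum_(s : 'S_n) (s == tperm i j)%:R * f (t * s)%g)).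
  rewrite -sumrB mulr_sumr; apply: eq_bigr => s _.
  by rewrite !ffunE /= -mulrBl mulrA.
by rewrite !delta_sum mulg1.
Qed.

Lemma L2_dot_Deltal b f g :
  L2_dot (ga_act (Delta b) f) g =
  \sum_(i < n) \sum_(j < n | (i < j)%N) (b i j)%:C%C *
     \sum_t (f t - f (t * tperm i j)%g) * (g t)^*.
Proof.
rewrite /L2_dot; under eq_bigr => t _ do rewrite ga_act_Delta mulr_suml.
rewrite exchange_big; apply: eq_bigr => i _ /=.
under eq_bigr => t _ do rewrite mulr_suml.
rewrite exchange_big; apply: eq_bigr => j _ /=.
by rewrite mulr_sumr; apply: eq_bigr => t _; rewrite mulrA.
Qed.

Lemma Delta_self_adjoint b : self_adjoint (ga_act (Delta b)).
Proof.
move=> f g; transitivity ((L2_dot (ga_act (Delta b) g) f)^*); last first.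
  by rewrite /L2_dot rmorph_sum; apply: eq_bigr => t _; rewrite rmorphM /= conjCK mulrC.
rewrite !L2_dot_Deltal rmorph_sum; apply: eq_bigr => i _.
rewrite rmorph_sum; apply: eq_bigr => j _; rewrite rmorphM /=.
congr (_ * _); first by symmetry; apply: conjc_real.
rewrite rmorph_sum.
under eq_bigr => t _ do rewrite mulrBl.
under [RHS]eq_bigr => t _ do rewrite rmorphM rmorphB /= conjCK mulrBl.
rewrite !sumrB; congr (_ - _); first by apply: eq_bigr => t _; rewrite mulrC.
rewrite (reindex_inj (mulIg (tperm i j))); apply: eq_bigr => t _ /=.
by rewrite -mulgA tperm2 mulg1 mulrC.
Qed.

(** Substituting t (ij) for t symmetrizes the form into half a sum of squared moduli, which splits
    into real and imaginary parts. *)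
Lemma L2_dot_Delta b f :
  L2_dot (ga_act (Delta b) f) f =
  (2^-1 * \sum_(i < n) \sum_(j < n | (i < j)%N) b i j *
     (swap_energy (fun t => complex.Re (f t)) i j
      + swap_energy (fun t => complex.Im (f t)) i j))%:C%C.
Proof.
rewrite L2_dot_Deltal mulr_sumr rmorph_sum; apply: eq_bigr => i _ /=.
rewrite mulr_sumr rmorph_sum; apply: eq_bigr => j _ /=.
rewrite mulrCA rmorphM; congr (_ * _).
rewrite /swap_energy -big_split mulr_sumr rmorph_sum /=.
set s := tperm i j.
have two_ne0 : (2 : R[i]) != 0 by rewrite pnatr_eq0.
apply: (mulfI two_ne0); rewrite mulr_sumr.
transitivity (\sum_t (f t - f (t * s)%g) * (f t - f (t * s)%g)^*).
  under [RHS]eq_bigr => t _ do rewrite rmorphB mulrBr.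
  rewrite sumrB -mulr_sumr mulr2n mulrDl !mul1r; congr (_ + _).
  rewrite (reindex_inj (mulIg s)) -sumrN; apply: eq_bigr => t _ /=.
  by rewrite -mulgA tperm2 mulg1 -mulNr opprB.
rewrite mulr_sumr; apply: eq_bigr => t _.
case: (f t) (f (t * s)%g) => [a c] [a' c'].
apply/eqP; rewrite eq_complex /=; apply/andP; split; apply/eqP; field; done.
Qed.

(** The quadratic form of a complex function is a sum of two real ones, so the comparison is only
    required on real functions. *)
Lemma Delta_ge b b' :
  (forall F : 'S_n -> R, \sum_(i < n) \sum_(j < n | (i < j)%N) b' i j * swap_energy F i j <=
      \sum_(i < n) \sum_(j < n | (i < j)%N) b i j * swap_energy F i j) ->
  op_ge (ga_act (Delta b)) (ga_act (Delta b')).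
Proof.
move=> le_b; split; [exact: Delta_self_adjoint | exact: Delta_self_adjoint | ].
have E f : ga_act (Delta b) f - ga_act (Delta b') f =
           ga_act (Delta (fun i j => b i j - b' i j)) f.
  apply/ffunP => t.
  transitivity (ga_act (Delta b) f t - ga_act (Delta b') f t); first by rewrite !ffunE.
  rewrite !ga_act_Delta -sumrB; apply: eq_bigr => i _.
  by rewrite -sumrB; apply: eq_bigr => j _; rewrite rmorphB -mulrBl.
split=> [f g|f] /=; first by rewrite !E; apply: Delta_self_adjoint.
rewrite E.
rewrite L2_dot_Delta ler0c mulr_ge0 ?invr_ge0 //.
pose D F := \sum_(i < n) \sum_(j < n | (i < j)%N) (b i j - b' i j) * swap_energy F i j.
have D0 F : 0 <= D F.
  have := le_b F; rewrite -subr_ge0 -sumrB.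
  under eq_bigr => i _ do (rewrite -sumrB; under eq_bigr => j _ do rewrite -mulrBl).
  by [].
rewrite (_ : \sum_(i < n) _ =
  D (fun t => complex.Re (f t)) + D (fun t => complex.Im (f t))); first exact: addr_ge0.
rewrite -big_split; apply: eq_bigr => i _; rewrite -big_split.
by apply: eq_bigr => j _; rewrite mulrDr.
Qed.

End Operators.

(** * Doubling the chain *)

Section Chain.
Variables (R : realType) (n : nat) (w : 'I_n -> 'I_n -> R).
Hypotheses (n_gt0 : (0 < n)%N) (hw : is_weight w).
Local Notation p := (trans_prob w).
Local Notation deg := (wdeg w).
Local Notation tot := (wtot w).
Local Notation pi := (stationary w).

Lemma weightC i j : w i j = w j i. Proof. by case: hw. Qed.
Lemma weight_ge0 i j : 0 <= w i j. Proof. by case: hw. Qed.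
Lemma weight_diag i : w i i = 0. Proof. by case: hw. Qed.
Lemma wdeg_gt0 i : 0 < deg i. Proof. by case: hw. Qed.
Hint Resolve weight_ge0 wdeg_gt0 : core.

Lemma wdegE i : deg i = \sum_j w i j.
Proof. by rewrite [RHS](bigD1 i) //= weight_diag add0r. Qed.

Lemma wtot_gt0 : 0 < tot.
Proof.
rewrite /wtot (bigD1 (Ordinal n_gt0)) //= ltr_wpDr //.
by apply: sumr_ge0 => i _; apply: ltW.
Qed.
Hint Resolve wtot_gt0 : core.

Lemma stationary_gt0 j : 0 < pi j.
Proof. by rewrite divr_gt0. Qed.
Hint Resolve stationary_gt0 : core.

Lemma sum_stationary : \sum_j pi j = 1.
Proof. by rewrite -mulr_suml divff // gt_eqF. Qed.

Lemma trans_prob0 i j : p 0 i j = (i == j)%:R.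
Proof. by rewrite /trans_prob expr0 mxE. Qed.

Lemma trans_prob1 i j : p 1 i j = if i == j then 1 / 2 else w i j / (2 * deg i).
Proof. by rewrite /trans_prob expr1 mxE. Qed.

Lemma trans_probD s t i j : p (s + t) i j = \sum_k p s i k * p t k j.
Proof. by rewrite /trans_prob exprD [LHS]mxE. Qed.

Lemma trans_prob_ge0 t i j : 0 <= p t i j.
Proof.
elim: t i j => [|t IH] i j; first by rewrite trans_prob0.
rewrite -addn1 trans_probD; apply: sumr_ge0 => k _; rewrite mulr_ge0 // trans_prob1.
by case: eqP => // _; rewrite divr_ge0 // mulr_ge0 // ltW.
Qed.

Lemma trans_prob1_off i : \sum_(j | j != i) p 1 i j = 1 / 2.
Proof.
under eq_bigr => j ji do rewrite trans_prob1 eq_sym (negPf ji).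
rewrite -mulr_suml -/(deg i); have := wdeg_gt0 i; set d := wdeg _ _ => d0.
by field; rewrite gt_eqF.
Qed.

Lemma trans_prob_sum t i : \sum_j p t i j = 1.
Proof.
elim: t i => [|t IH] i.
  rewrite (bigD1 i) //= trans_prob0 eqxx big1 ?addr0 // => j ji.
  by rewrite trans_prob0 eq_sym (negPf ji).
under eq_bigr => j _ do rewrite -addn1 trans_probD.
rewrite exchange_big -[RHS](IH i); apply: eq_bigr => k _ /=.
rewrite -mulr_sumr (bigD1 k) //= trans_prob1_off trans_prob1 eqxx -splitr.
by rewrite mulr1.
Qed.

Lemma trans_probC t i j : deg i * p t i j = deg j * p t j i.
Proof.
elim: t i j => [|t IH] i j.
  by rewrite !trans_prob0 eq_sym; case: eqP => [->|]; rewrite ?mulr0.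
have p1C a b : deg a * p 1 a b = deg b * p 1 b a.
  rewrite !trans_prob1 (eq_sym b a); case: eqP => [->//|_].
  by rewrite (weightC b a); field; rewrite !gt_eqF.
rewrite -[in LHS](addn1 t) -[in RHS](add1n t) !trans_probD !mulr_sumr; apply: eq_bigr => k _.
by rewrite mulrA IH mulrAC p1C; ring.
Qed.

Lemma trans_prob_le1 t i j : p t i j <= 1.
Proof.
rewrite -(trans_prob_sum t i) (bigD1 j) //= lerDl.
by apply: sumr_ge0 => k _; apply: trans_prob_ge0.
Qed.

(** One more initial step averages rows that all exceed 3/4 of [pi]; strictness survives through the
    holding probability 1/2. *)
Lemma mixed_leq s t : (s <= t)%N -> mixed w s -> mixed w t.
Proof.
move=> /subnK <-; elim: (t - s)%N => [//|d IH] /IH /forallP m.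
apply/forallP => i; apply/forallP => j; rewrite addSn -(add1n (d + s)) trans_probD.
have -> : 3 / 4 * pi j = \sum_k p 1 i k * (3 / 4 * pi j).
  by rewrite -mulr_suml trans_prob_sum mul1r.
rewrite [ltLHS](bigD1 i) //= [ltRHS](bigD1 i) //= ltr_leD //.
  rewrite ltr_pM2l; first exact: (forallP (m i)).
  by rewrite trans_prob1 eqxx divr_gt0.
apply: ler_sum => k _; apply: ler_wpM2l; first exact: trans_prob_ge0.
exact/ltW/(forallP (m k)).
Qed.

(** At time 0 a second point has not been reached. Hence a finite [dmix] is positive and may be
    divided by. *)
Lemma not_mixed0 : (1 < n)%N -> ~~ mixed w 0.
Proof.
move=> n1; apply/negP => /forallP m.
have := forallP (m (Ordinal n_gt0)) (Ordinal n1).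
apply/negP; rewrite trans_prob0 /= -leNgt; apply: mulr_ge0; first by rewrite divr_ge0.
exact: ltW (stationary_gt0 _).
Qed.

Variant dmix_spec : option nat -> Prop :=
| DmixSome d of mixed w d & (forall t, mixed w t -> (d <= t)%N) : dmix_spec (Some d)
| DmixNone of (forall t, ~~ mixed w t) : dmix_spec None.

Lemma dmixP : dmix_spec (dmix w).
Proof.
rewrite /dmix; case: pselect => [ex|nex].
  by case: ex_minnP => d m dmin; constructor.
by constructor=> t; apply/negP => m; apply: nex; exists t.
Qed.

Section Comparison.
Variable F : 'S_n -> R.

Definition chain_energy t : R := \sum_i \sum_j deg i * p t i j * swap_energy F i j.

Lemma swap_energy_ge0 i j : 0 <= swap_energy F i j.
Proof. by apply: sumr_ge0 => t _; apply: sqr_ge0. Qed.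

Lemma swap_energy_diag i : swap_energy F i i = 0.
Proof. by rewrite /swap_energy big1 // => t _; rewrite tperm1 mulg1 subrr expr0n. Qed.

(** Laziness gives w_i p_1(i,j) = w_ij / 2 off the diagonal, and B_ii = 0. *)
Lemma chain_energy1 : \sum_i \sum_j w i j * swap_energy F i j = 2 * chain_energy 1.
Proof.
rewrite /chain_energy mulr_sumr; apply: eq_bigr => i _.
rewrite mulr_sumr; apply: eq_bigr => j _; rewrite trans_prob1.
case: eqP => [->|_]; first by rewrite swap_energy_diag !mulr0.
by field; rewrite gt_eqF.
Qed.

Lemma chain_energy_double t : chain_energy (t + t) <= 2 * chain_energy t.
Proof.
(* Paths of length 2t are seen from their midpoint [v]: reversibility replaces w_i p_t(i,v) by w_v
   p_t(v,i). *)
have -> : chain_energy (t + t) =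
    \sum_v deg v * \sum_i \sum_j p t v i * p t v j * swap_energy F i j.
  transitivity (\sum_i \sum_j \sum_v deg v * (p t v i * p t v j * swap_energy F i j)).
    apply: eq_bigr => i _; apply: eq_bigr => j _.
    rewrite trans_probD mulr_sumr mulr_suml; apply: eq_bigr => v _.
    by rewrite mulrA trans_probC; ring.
  under eq_bigr => i _ do rewrite exchange_big.
  rewrite exchange_big; apply: eq_bigr => v _.
  by rewrite mulr_sumr; apply: eq_bigr => i _; rewrite mulr_sumr.
rewrite /chain_energy mulr_sumr; apply: ler_sum => v _.
have := octopus v F (trans_prob_ge0 t v); rewrite trans_prob_sum mulr1 => O.
apply: (le_trans (ler_wpM2l (ltW (wdeg_gt0 v)) O)).
rewrite mulrCA ler_pM2l // mulr_sumr.
by apply: ler_sum => j _; rewrite mulrA.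
Qed.

Lemma chain_energy_pow2 k : chain_energy (2 ^ k) <= 2 ^+ k * chain_energy 1.
Proof.
elim: k => [|k IH]; first by rewrite mul1r.
rewrite expnS mul2n -addnn exprS -mulrA.
by apply: (le_trans (chain_energy_double _)); rewrite ler_pM2l.
Qed.

Lemma min_wdeg_sq_le i j : min_wdeg_sq w <= deg i * deg j.
Proof.
have le_sq k : min_wdeg_sq w <= deg k ^+ 2 by apply: bigmin_le_cond.
have [ij|/ltW ji] := leP (deg i) (deg j).
  by apply: (le_trans (le_sq i)); rewrite expr2 ler_pM2l.
by apply: (le_trans (le_sq j)); rewrite expr2 ler_pM2r.
Qed.

Lemma comparison : (1 < n)%N ->
  3 / 4 * inv_dmix w * (min_wdeg_sq w / tot) * \sum_i \sum_j swap_energy F i j <=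
  \sum_i \sum_j w i j * swap_energy F i j.
Proof.
move=> n1; rewrite /inv_dmix; case: dmixP => [d md dmin|_]; last first.
  rewrite mulr0 !mul0r; apply: sumr_ge0 => i _; apply: sumr_ge0 => j _.
  by rewrite mulr_ge0 ?swap_energy_ge0.
have d0 : (0 < d)%N by case: d md {dmin} => // m; case/negP: (not_mixed0 n1).
(* 2^k is the power of two with d < 2^k <= 2 d. *)
set k := (trunc_log 2 d).+1.
have dk : (d <= 2 ^ k)%N by apply/ltnW/trunc_log_ltn.
have kd : (2 ^ k <= 2 * d)%N by rewrite expnS leq_mul2l trunc_logP.
have low : 3 / 4 * (min_wdeg_sq w / tot) * \sum_i \sum_j swap_energy F i j <=
    chain_energy (2 ^ k).
  rewrite /chain_energy mulr_sumr; apply: ler_sum => i _.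
  rewrite mulr_sumr; apply: ler_sum => j _.
  rewrite ler_wpM2r ?swap_energy_ge0 //.
  have /ltW m := forallP (forallP (mixed_leq dk md) i) j.
  apply: le_trans (ler_wpM2l (ltW (wdeg_gt0 i)) m).
  rewrite /stationary [leRHS](_ : _ = 3 / 4 * (deg i * deg j / tot)); last by ring.
  by rewrite ler_pM2l ?divr_gt0 // ler_pM2r ?invr_gt0 // min_wdeg_sq_le.
rewrite chain_energy1; move: low; set X := \sum_i _; set a := _ / tot => low.
rewrite (_ : 3 / 4 / d%:R * a * X = 3 / 4 * a * X / d%:R); last by ring.
rewrite ler_pdivrMr ?ltr0n //.
apply: (le_trans low); apply: (le_trans (chain_energy_pow2 k)).
(* The 2 in 2^k <= 2 d is the factor from [chain_energy1]. *)
rewrite mulrAC ler_wpM2r //; last by rewrite -natrX -natrM ler_nat.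
apply: sumr_ge0 => i _; apply: sumr_ge0 => j _.
by rewrite !mulr_ge0 ?swap_energy_ge0 ?trans_prob_ge0 // ltW.
Qed.

End Comparison.
End Chain.

(** * Decay of return probabilities *)

(** By Lagrange's identity twice the difference is the sum of a_i a_j (g_i - g_j)^2. *)
Lemma weighted_cauchy (R : realFieldType) (I : finType) (a g : I -> R) :
  (forall i, 0 <= a i) ->
  (\sum_i a i * g i) ^+ 2 <= (\sum_i a i) * \sum_i a i * g i ^+ 2.
Proof.
move=> a0.
have E : 2 * ((\sum_i a i) * (\sum_i a i * g i ^+ 2) - (\sum_i a i * g i) ^+ 2) =
    \sum_i \sum_j a i * a j * (g i - g j) ^+ 2.
  rewrite mulrBr mulrA double_weighted_sum expr2 mulr_suml mulr_sumr -sumrB.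
  apply: eq_bigr => i _; rewrite !mulr_sumr -sumrB.
  by apply: eq_bigr => j _; ring.
rewrite -subr_ge0 -(pmulr_rge0 _ (ltr0n R 2)) E.
by apply: sumr_ge0 => i _; apply: sumr_ge0 => j _;
  rewrite mulr_ge0 ?sqr_ge0 ?mulr_ge0.
Qed.

Section Decay.
Variables (R : realFieldType) (u : nat -> R) (T : R).
Hypotheses (T_gt0 : 0 < T) (u_ge1 : forall t, 1 <= u t).
Hypothesis u_noninc : forall t, u t.+1 <= u t.
Hypothesis u_nash : forall t, 2 <= u t -> u t ^+ 3 <= 8 * T * (u t - u t.+1).
Hypothesis u_gap : forall t, u t - 1 <= T * (u t - u t.+1).

(** While u >= 2, the Nash inequality makes u^-2 grow by at least 1/(8T) per step. *)
Lemma decay_nash t : 2 <= u t -> t%:R * u t ^+ 2 <= 8 * T.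
Proof.
elim: t => [|t IH] ut1; first by rewrite mul0r mulr_ge0 // ltW.
have ut := le_trans ut1 (u_noninc t).
have := u_noninc t; have := IH ut; have := u_nash ut; move: ut1 ut.
set a := u t; set b := u t.+1 => b2 a2 nash tb ba.
have a0 : 0 < a by lra.
have b0 : 0 < b by lra.
rewrite -(ler_pM2r (exprn_gt0 3 a0)).
have b2_ge0 := sqr_ge0 b.
have H1 : t%:R * a ^+ 2 * (a * b ^+ 2) <= 8 * T * (a * b ^+ 2).
  by apply: ler_wpM2r => //; apply: mulr_ge0 => //; apply: ltW.
have H2 : a ^+ 3 * b ^+ 2 <= 8 * T * (a - b) * b ^+ 2 by apply: ler_wpM2r.
(* The product equals a^3 - 2 a b^2 + b^3, the slack left after adding [H1] and [H2]. *)
have H3 : 0 <= 8 * T * ((a - b) * (a ^+ 2 + b * (a - b))).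
  apply: mulr_ge0; first by apply: mulr_ge0; [|apply: ltW].
  have ab : 0 <= a - b by rewrite subr_ge0.
  by apply: mulr_ge0 => //; apply: addr_ge0; [apply: sqr_ge0|apply: mulr_ge0 => //; apply: ltW].
rewrite -natr1; move: H1 H2 H3; lra.
Qed.

(** By time [t] the Nash decay has brought u below 2; the gap takes over for the remaining [s]
    steps. *)
Lemma decay_gap t s : 2 * T < t%:R -> 4 * T < s%:R -> u (t + s) - 1 < 1 / 4.
Proof.
move=> tT sT.
have ut : u t < 2.
  rewrite ltNge; apply/negP => u2; have := decay_nash u2.
  have : t%:R * 4 <= t%:R * u t ^+ 2 :> R.
    by rewrite ler_wpM2l ?ler0n // -[4](_ : 2 ^+ 2 = _) ?ler_sqr // ?nnegrE; lra.
  lra.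
(* The gap inequality summed over [s] steps, each term bounded below by the last since u is
   nonincreasing. *)
have S : (s%:R + T) * (u (t + s) - 1) <= T * (u t - 1).
  elim: s {sT} => [|s IH]; first by rewrite addn0 add0r.
  apply: le_trans IH; have := u_gap (t + s); have := u_noninc (t + s).
  rewrite addnS; have := u_ge1 (t + s).+1; have : 0 <= s%:R :> R by rewrite ler0n.
  rewrite -natr1; set a := u (t + s); set b := u _; set c := s%:R => c0 b1 ba g.
  have : c * b <= c * a by rewrite ler_wpM2l.
  lra.
have := u_ge1 (t + s); move: S; set v := u (t + s) => S v1.
rewrite ltNge; apply/negP => v4.
have : 4 * T * (1 / 4) <= s%:R * (v - 1).
  by apply: ler_pM; move: T_gt0 sT v4; lra.
have : T * (v - 1) >= 0 by rewrite mulr_ge0 ?subr_ge0 // ltW.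
have : T * (u t - 1) < T * 1 by rewrite ltr_pM2l //; lra.
lra.
Qed.

End Decay.

(** Factors are at most 2 until 2^k is of order [b]; from there P_k decays geometrically and the
    remaining product stays bounded. *)
Lemma prod_decay (R : realType) (P : nat -> R) (b : R) (K : nat) :
  1 <= b -> (forall k, 0 <= P k <= 1) ->
  (forall k, (0 < k <= K)%N -> P k ^+ 2 * 2 ^+ k <= b) ->
  \prod_(0 <= k < K.+1) (1 + P k) <= 256 * b.
Proof.
move=> b1 P01 Pb.
(* The threshold [j] built from [N] satisfies 64 b <= 2^j <= 128 b. *)
set N := Num.trunc (64 * b).
have /andP [Nle Ngt] : N%:R <= 64 * b < N.+1%:R.
  by apply: truncn_itv; lra.
have N0 : (0 < N)%N by rewrite -ltnS -(ltr_nat R); move: Ngt; set y := N.+1%:R; lra.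
set j := (trunc_log 2 N).+1.
have j_up : 2 ^+ j <= 128 * b.
  have : 2 ^+ (trunc_log 2 N) <= N%:R :> R by rewrite -natrX ler_nat trunc_logP.
  rewrite exprS; lra.
have j_low : 64 * b <= 2 ^+ j.
  by apply: (le_trans (ltW Ngt)); rewrite -natrX ler_nat trunc_log_ltn.
have P_low : forall M, (M <= j)%N -> \prod_(0 <= k < M) (1 + P k) <= 2 ^+ M.
  elim=> [|M IH] Mj; first by rewrite big_geq.
  rewrite big_nat_recr //= exprSr ler_pM ?IH ?(ltnW Mj) //.
  - by apply: prodr_ge0 => k _; have := P01 k; lra.
  - by have := P01 M; lra.
  - by have := P01 M; lra.
(* The induction closes because (2 - r)(1 + r/8) <= 2 - 3r/4 for r = (3/4)^i. *)
have P_high : forall i, (j + i <= K.+1)%N ->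
    \prod_(0 <= k < j + i) (1 + P k) <= 2 ^+ j * (2 - (3 / 4) ^+ i).
  elim=> [|i IH] ji; first by rewrite addn0 (le_trans (P_low _ _)) // expr0; lra.
  rewrite addnS big_nat_recr //=.
  have r0 : 0 <= (3 / 4) ^+ i :> R by rewrite exprn_ge0 //; lra.
  have r1 : (3 / 4) ^+ i <= 1 :> R by rewrite exprn_ile1 //; lra.
  (* The hypothesis gives P^2 <= 2^-i / 64, and 1/2 < (3/4)^2. *)
  have Pi : P (j + i)%N <= (3 / 4) ^+ i / 8.
    have /andP [P0 _] := P01 (j + i)%N.
    rewrite -(@ler_pXn2r R 2) ?nnegrE ?divr_ge0 //.
    (* [j] is a successor, so the excluded index 0 does not occur. *)
    have := Pb (j + i)%N; rewrite addSn /= -addSn -ltnS -addnS ji => /(_ isT).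
    rewrite exprD => H.
    have q0 : 0 < 2 ^+ i :> R by rewrite exprn_gt0.
    have H1 : P (j + i)%N ^+ 2 * 2 ^+ i <= 1 / 64.
      have : (P (j + i)%N ^+ 2 * 2 ^+ i) * (64 * b) <=
             (P (j + i)%N ^+ 2 * 2 ^+ i) * 2 ^+ j.
        by rewrite ler_wpM2l // mulr_ge0 ?sqr_ge0 // ltW.
      move: H; set y := P _ ^+ 2; set z := 2 ^+ i; set z' := 2 ^+ j => H H'.
      have : (y * z) * (64 * b) <= 1 / 64 * (64 * b) by lra.
      by rewrite ler_pM2r //; lra.
    rewrite -(ler_pM2r q0) (le_trans H1) // expr_div_n -exprM mulnC exprM -mulrAC -exprMn.
    rewrite [leLHS](_ : _ = 1 ^+ i / 64); last by rewrite expr1n.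
    rewrite [8 ^+ 2](_ : _ = 64); last by ring.
    by rewrite ler_pM2r ?invr_gt0 // lerXn2r ?nnegrE //; lra.
  apply: (le_trans (ler_pM _ _ (IH (ltnW _)) (lexx _))); last first.
  - rewrite -mulrA ler_wpM2l ?exprn_ge0 // exprSr.
    move: r0 r1 Pi; set r := _ ^+ i; have := P01 (j + i)%N; set y := P _ => y01 r0 r1 yr.
    have : (2 - r) * y <= (2 - r) * (r / 8) by rewrite ler_wpM2l //; lra.
    have : 0 <= r * r by rewrite mulr_ge0.
    lra.
  - by move: ji; rewrite addnS.
  - by have := P01 (j + i)%N; lra.
  - by apply: prodr_ge0 => k _; have := P01 k; lra.
have [Kj|jK] := leqP K.+1 j.
  apply: (le_trans (P_low _ Kj)); apply: (@le_trans _ _ (2 ^+ j)); last by lra.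
  by rewrite ler_eXn2l //; lra.
rewrite -(subnKC (ltnW jK)); apply: (le_trans (P_high _ _)); first by rewrite subnKC // ltnW.
have : 0 <= (3 / 4) ^+ (K.+1 - j) :> R by rewrite exprn_ge0 //; lra.
set r := _ ^+ (_ - _) => r0.
have : 2 ^+ j * (2 - r) <= 2 ^+ j * 2 by rewrite ler_wpM2l ?exprn_ge0 //; lra.
lra.
Qed.

(** * Mixing time and return probabilities under an escape bound *)

Section Mixing.
Variables (R : realType) (n : nat) (w : 'I_n -> 'I_n -> R).
Hypotheses (n_gt0 : (0 < n)%N) (hw : is_weight w).
Local Notation p := (trans_prob w).
Local Notation deg := (wdeg w).
Local Notation tot := (wtot w).
Local Notation pi := (stationary w).

Let pi_gt0 j : 0 < pi j := stationary_gt0 n_gt0 hw j.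
Let pi_ge0 j : 0 <= pi j := ltW (pi_gt0 j).
Let pi_sum : \sum_j pi j = 1 := sum_stationary n_gt0 hw.
Let tot_gt0 : 0 < tot := wtot_gt0 n_gt0 hw.

(** The Dirichlet form of the lazy chain, half the sum of pi_i p_1(i,j) (h_i - h_j)^2; laziness
    contributes the second factor 1/2. *)
Definition edge_energy (h : 'I_n -> R) : R :=
  (4 * tot)^-1 * \sum_i \sum_j w i j * (h i - h j) ^+ 2.

Lemma edge_energy_ge0 h : 0 <= edge_energy h.
Proof.
apply: mulr_ge0; first by rewrite invr_ge0 mulr_ge0 // ltW.
apply: sumr_ge0 => i _; apply: sumr_ge0 => j _.
by apply: mulr_ge0; [apply: weight_ge0 | apply: sqr_ge0].
Qed.

Lemma stationary_reversible t i j : pi i * p t i j = pi j * p t j i.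
Proof. by rewrite /stationary mulrAC trans_probC // mulrAC. Qed.

(* Laziness makes the row variance at least half the mean squared increment. *)
Lemma row_variance_ge (h : 'I_n -> R) i :
  1 / 2 * \sum_j p 1 i j * (h j - h i) ^+ 2 <=
  \sum_j p 1 i j * h j ^+ 2 - (\sum_j p 1 i j * h j) ^+ 2.
Proof.
pose a j := if j == i then 0 else p 1 i j.
have a0 j : 0 <= a j by rewrite /a; case: eqP => // _; apply: trans_prob_ge0.
have a_sum : \sum_j a j = 1 / 2.
  rewrite -(trans_prob1_off hw i) [RHS]big_mkcond; apply: eq_bigr => j _.
  by rewrite /a; case: eqP.
have aE (F : 'I_n -> R) : F i = 0 -> \sum_j a j * F j = \sum_j p 1 i j * F j.
  move=> Fi; apply: eq_bigr => j _; rewrite /a; case: eqP => // ->.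
  by rewrite Fi !mulr0.
have := weighted_cauchy (fun j => h j - h i) a0.
rewrite a_sum !aE ?subrr ?expr0n //.
have -> : \sum_j p 1 i j * (h j - h i) = \sum_j p 1 i j * h j - h i.
  under eq_bigr => j _ do rewrite mulrBr.
  by rewrite sumrB -mulr_suml trans_prob_sum // mul1r.
have -> : \sum_j p 1 i j * (h j - h i) ^+ 2 =
    \sum_j p 1 i j * h j ^+ 2 - 2 * h i * (\sum_j p 1 i j * h j) + h i ^+ 2.
  transitivity (\sum_j p 1 i j * h j ^+ 2 - 2 * h i * (\sum_j p 1 i j * h j)
    + h i ^+ 2 * \sum_j p 1 i j); last by rewrite trans_prob_sum // mulr1.
  rewrite !mulr_sumr -sumrB -big_split.
  by apply: eq_bigr => j _ /=; ring.
set X := \sum_j _; set Y := \sum_j _; lra.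
Qed.

(** By stationarity the right side is the [pi]-mean of the row variances bounded in
    [row_variance_ge]. *)
Lemma dirichlet_decay (h : 'I_n -> R) :
  edge_energy h <=
  \sum_i pi i * h i ^+ 2 - \sum_i pi i * (\sum_j p 1 i j * h j) ^+ 2.
Proof.
have -> : edge_energy h =
    \sum_i pi i * (1 / 2 * \sum_j p 1 i j * (h j - h i) ^+ 2).
  rewrite /edge_energy [LHS]mulr_sumr; apply: eq_bigr => i _.
  rewrite mulrA [LHS]mulr_sumr [RHS]mulr_sumr; apply: eq_bigr => j _.
  rewrite trans_prob1; case: (eqVneq i j) => [->|_].
    by rewrite !subrr expr0n !mulr0.
  rewrite /stationary; have := wdeg_gt0 hw i; have := tot_gt0.
  by move: tot (wdeg w i) => a b a0 b0; field; rewrite !gt_eqF.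
have -> : \sum_i pi i * h i ^+ 2 = \sum_i pi i * \sum_j p 1 i j * h j ^+ 2.
  under [RHS]eq_bigr => i _ do rewrite mulr_sumr.
  rewrite exchange_big; apply: eq_bigr => j _ /=.
  rewrite -[in LHS](mul1r (h j ^+ 2)) -(trans_prob_sum hw 1 j) mulr_suml mulr_sumr.
  by apply: eq_bigr => i _; rewrite !mulrA stationary_reversible.
rewrite -sumrB; apply: ler_sum => i _; rewrite -mulrBr.
by rewrite ler_wpM2l ?row_variance_ge.
Qed.

(* By reversibility this is also p t x y / pi y. *)
Definition density t x y : R := p t y x / pi x.

(** The quantity u_t; at the doubled time it is the squared norm of [density t x] in L2(pi). *)
Definition return_ratio x t : R := p (t + t) x x / pi x.

Lemma density_ge0 t x y : 0 <= density t x y.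
Proof. by rewrite divr_ge0 // trans_prob_ge0. Qed.

Lemma densityE t x y : p t x y = pi y * density t x y.
Proof. by rewrite mulrA -stationary_reversible mulrAC divff ?mul1r // gt_eqF. Qed.

Lemma density_mean t x : \sum_y pi y * density t x y = 1.
Proof.
by under eq_bigr => y _ do rewrite -densityE; rewrite trans_prob_sum.
Qed.

Lemma densityS t x y : density t.+1 x y = \sum_z p 1 y z * density t x z.
Proof.
rewrite /density -add1n trans_probD mulr_suml; apply: eq_bigr => z _.
by rewrite mulrA.
Qed.

Lemma density_dot t x y :
  \sum_z pi z * (density t x z * density t y z) = p (t + t) x y / pi y.
Proof.
rewrite trans_probD mulr_suml; apply: eq_bigr => z _.
by rewrite mulrA -densityE mulrA.
Qed.

Lemma density_norm t x : \sum_y pi y * density t x y ^+ 2 = return_ratio x t.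
Proof. by under eq_bigr => y _ do rewrite expr2; rewrite density_dot. Qed.

Lemma return_ratio_step x t :
  edge_energy (density t x) <= return_ratio x t - return_ratio x t.+1.
Proof.
rewrite -!density_norm; under [X in _ - X]eq_bigr => y _ do rewrite densityS.
exact: dirichlet_decay.
Qed.

Lemma density_variance t x :
  \sum_y pi y * (density t x y - 1) ^+ 2 = return_ratio x t - 1.
Proof.
rewrite -density_norm.
transitivity (\sum_y pi y * density t x y ^+ 2
   - 2 * (\sum_y pi y * density t x y) + \sum_y pi y).
  by rewrite mulr_sumr -sumrB -big_split; apply: eq_bigr => y _ /=; ring.
by rewrite density_mean pi_sum; ring.
Qed.

Lemma return_ratio_ge1 x t : 1 <= return_ratio x t.
Proof.
rewrite -subr_ge0 -density_variance; apply: sumr_ge0 => y _.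
by apply: mulr_ge0; [|apply: sqr_ge0].
Qed.

Lemma return_ratio_noninc x t : return_ratio x t.+1 <= return_ratio x t.
Proof.
by rewrite -subr_ge0 (le_trans (edge_energy_ge0 _) (return_ratio_step x t)).
Qed.

(** p_2t(x,y) / pi(y) - 1 is the inner product of two centred densities, at least minus the mean of
    their variances, hence above -1/4. *)
Lemma return_ratio_mixed t :
  (forall x, return_ratio x t - 1 < 1 / 4) -> mixed w (t + t).
Proof.
move=> small; apply/forallP => x; apply/forallP => y.
rewrite -ltr_pdivlMr // -density_dot.
have -> : \sum_z pi z * (density t x z * density t y z) =
    1 + \sum_z pi z * ((density t x z - 1) * (density t y z - 1)).
  transitivity (\sum_z pi z * density t x z + \sum_z pi z * density t y z - \sum_z pi z
    + \sum_z pi z * ((density t x z - 1) * (density t y z - 1))).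
    by rewrite -big_split -sumrB -big_split; apply: eq_bigr => z _ /=; ring.
  by rewrite !density_mean pi_sum; ring.
have : - (1 / 2 * (return_ratio x t - 1 + (return_ratio y t - 1))) <=
    \sum_z pi z * ((density t x z - 1) * (density t y z - 1)).
  rewrite -!density_variance -big_split mulr_sumr -sumrN; apply: ler_sum => z _ /=.
  set a := density t x z - 1; set b := density t y z - 1.
  have : 0 <= pi z * (a + b) ^+ 2 by apply: mulr_ge0; [|apply: sqr_ge0].
  lra.
have := small x; have := small y; lra.
Qed.

(* The effective resistance from x to the complement of a superlevel set of measure a
   is at most T a. *)
Definition escape_bound (T : R) : Prop :=
  forall (h : 'I_n -> R) x s, s < h x -> (exists y, h y <= s) ->
    (h x - s) ^+ 2 <= T * (\sum_(a | s < h a) pi a) * edge_energy h.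

Section EscapeBound.
Variable T : R.
Hypotheses (T_ge1 : 1 <= T) (escape : escape_bound T).

Let T_gt0 : 0 < T. Proof. exact: lt_le_trans T_ge1. Qed.

Lemma exists_le_mean (h : 'I_n -> R) m : \sum_i pi i * h i = m -> exists y, h y <= m.
Proof.
move=> hm; apply: contrapT => no.
have lt y : m < h y by rewrite ltNge; apply/negP => le; apply: no; exists y.
suff: m < \sum_i pi i * h i by rewrite hm ltxx.
rewrite -[ltLHS]mul1r -pi_sum mulr_suml.
apply: ltr_sum => [|i _]; last by rewrite ltr_pM2l.
by apply/hasP; exists (Ordinal n_gt0) => //; rewrite mem_index_enum.
Qed.

(** The variance is at most (max h - min h)^2; the escape bound applies at the maximum with level
    min h, where the superlevel set has measure at most 1. *)
Lemma escape_gap (h : 'I_n -> R) : \sum_i pi i * h i = 1 ->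
  \sum_i pi i * (h i - 1) ^+ 2 <= T * edge_energy h.
Proof.
move=> h1.
have [x _ xmax] := arg_maxP h (erefl true : predT (Ordinal n_gt0)).
have [y _ ymin] := arg_minP h (erefl true : predT (Ordinal n_gt0)).
have y_le1 : h y <= 1.
  by have [z z1] := exists_le_mean h1; apply: le_trans z1; apply: ymin.
have x_ge1 : 1 <= h x.
  have : \sum_i pi i * - h i = - 1.
    by under eq_bigr => i _ do rewrite mulrN; rewrite sumrN h1.
  case/exists_le_mean=> z; rewrite lerN2 => z1; apply: le_trans z1 _; exact: xmax.
have osc : \sum_i pi i * (h i - 1) ^+ 2 <= (h x - h y) ^+ 2.
  apply: (@le_trans _ _ (\sum_i pi i * (h x - h y) ^+ 2)); last first.
    by rewrite -mulr_suml pi_sum mul1r.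
  apply: ler_sum => i _; apply: ler_wpM2l => //.
  have xi : h i <= h x := xmax i isT; have yi : h y <= h i := ymin i isT.
  rewrite -subr_ge0 subr_sqr; move: (h x) (h y) (h i) x_ge1 y_le1 xi yi => a b c.
  by move=> *; apply: mulr_ge0; lra.
apply: (le_trans osc); have [yx|xy] := ltP (h y) (h x); last first.
  have -> : h x - h y = 0 by lra.
  by rewrite expr0n mulr_ge0 ?edge_energy_ge0 // ltW.
apply: (le_trans (escape yx _)); first by exists y.
rewrite ler_wpM2r ?edge_energy_ge0 // ler_piMr ?(ltW T_gt0) //.
by rewrite -pi_sum [leRHS](bigID (fun a => h y < h a)) lerDl sumr_ge0.
Qed.

(** The maximum of h is at least u. At level u/2, Markov bounds the superlevel measure by 2/u, so
    (u/2)^2 <= T (2/u) E. For u >= 2 the level is at least the mean, so some value lies at or below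
    it. *)
Lemma escape_nash (h : 'I_n -> R) : (forall i, 0 <= h i) ->
  \sum_i pi i * h i = 1 -> 2 <= \sum_i pi i * h i ^+ 2 ->
  (\sum_i pi i * h i ^+ 2) ^+ 3 <= 8 * T * edge_energy h.
Proof.
move=> h0 h1; set u := \sum_i _ => u2.
have [x _ xmax] := arg_maxP h (erefl true : predT (Ordinal n_gt0)).
have xu : u <= h x.
  rewrite -[leRHS]mul1r -h1 mulr_suml; apply: ler_sum => i _.
  by rewrite expr2 mulrA; apply: ler_wpM2l; [apply: mulr_ge0 | apply: xmax].
have T0 := T_gt0; have [y y1] := exists_le_mean h1.
have s_lt : u / 2 < h x by lra.
have y_le : exists y, h y <= u / 2 by exists y; lra.
have markov : u / 2 * (\sum_(a | u / 2 < h a) pi a) <= 1.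
  rewrite -[leRHS]h1 [leRHS](bigID (fun a => u / 2 < h a)) /= ler_wpDr //.
    by apply: sumr_ge0 => i _; rewrite mulr_ge0.
  by rewrite mulr_sumr; apply: ler_sum => i /ltW hi; rewrite mulrC ler_wpM2l.
have := escape s_lt y_le; move: markov; set A := \sum_(a | _) _ => A1 H.
have E0 := edge_energy_ge0 h; move: H E0; set E := edge_energy h => H E0.
have H1 : (u / 2) ^+ 2 <= T * A * E.
  by apply: le_trans H; rewrite ler_sqr ?nnegrE; lra.
have H2 : u * (u / 2) ^+ 2 <= u * (T * A * E) by rewrite ler_wpM2l //; lra.
have H3 : T * E * (u / 2 * A) <= T * E * 1.
  by apply: ler_wpM2l => //; apply: mulr_ge0 => //; apply: ltW.
lra.
Qed.

Lemma return_ratio_nash x t : 2 <= return_ratio x t ->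
  return_ratio x t ^+ 3 <= 8 * T * (return_ratio x t - return_ratio x t.+1).
Proof.
rewrite -{1 2}density_norm => u2.
apply: (le_trans (escape_nash (density_ge0 t x) (density_mean t x) u2)).
by rewrite ler_pM2l ?return_ratio_step // mulr_gt0.
Qed.

Lemma return_ratio_gap x t :
  return_ratio x t - 1 <= T * (return_ratio x t - return_ratio x t.+1).
Proof.
rewrite -{1}density_variance; apply: (le_trans (escape_gap (density_mean t x))).
by rewrite ler_pM2l ?return_ratio_step.
Qed.

Lemma dmix_le : exists2 d, dmix w = Some d & d%:R <= 20 * T.
Proof.
have T0 := T_gt0; have T1 := T_ge1.
have trunc_succ (y : R) : 0 <= y -> y < (Num.trunc y).+1%:R <= y + 1.
  by move=> /truncn_itv /andP [yl yu]; rewrite yu -natr1 lerD2r.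
(* Integers just above the thresholds 2T and 4T of [decay_gap]; the doubled time is at most 12 T +
   4. *)
have /andP [s1 s1'] : 2 * T < (Num.trunc (2 * T)).+1%:R <= 2 * T + 1.
  by apply: trunc_succ; lra.
have /andP [s2 s2'] : 4 * T < (Num.trunc (4 * T)).+1%:R <= 4 * T + 1.
  by apply: trunc_succ; lra.
set t := (Num.trunc (2 * T)).+1 in s1 s1'; set s := (Num.trunc (4 * T)).+1 in s2 s2'.
have m : mixed w ((t + s) + (t + s)).
  apply: return_ratio_mixed => x.
  exact: (decay_gap T_gt0 (return_ratio_ge1 x) (return_ratio_noninc x)
            (@return_ratio_nash x) (return_ratio_gap x)).
case: (dmixP w) => [d _ dmin|/(_ _) /negP no]; last by case: (no _ m).
exists d => //; have := dmin _ m; rewrite -(ler_nat R) !natrD; lra.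
Qed.

(** If u >= 2 this is the Nash decay; if u < 2, the bound [d] <= 20 T on the time suffices. *)
Lemma return_ratio_le x k d : dmix w = Some d -> (0 < 2 ^ k.+1 <= d)%N ->
  return_ratio x (2 ^ k) ^+ 2 * 2 ^+ k.+1 <= 80 * T.
Proof.
move=> dE /andP [_ kd]; have T0 := T_gt0; have [d' dE' dT] := dmix_le.
move: dE'; rewrite dE => -[E]; rewrite -E in dT.
have k_le : 2 ^+ k.+1 <= 20 * T by apply: le_trans dT; rewrite -natrX ler_nat.
have [u2|u2] := leP 2 (return_ratio x (2 ^ k)).
  have := decay_nash T_gt0 (return_ratio_noninc x) (@return_ratio_nash x) u2.
  by rewrite natrX (exprS _ k); lra.
have u1 := return_ratio_ge1 x (2 ^ k).
have u4 : return_ratio x (2 ^ k) ^+ 2 <= 2 ^+ 2 by rewrite ler_sqr ?nnegrE; lra.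
have : return_ratio x (2 ^ k) ^+ 2 * 2 ^+ k.+1 <= 2 ^+ 2 * (20 * T).
  by apply: ler_pM => //; [apply: sqr_ge0 | rewrite exprn_ge0].
lra.
Qed.

End EscapeBound.
End Mixing.

(** * Lower bounds for delta *)

Section DeltaBounds.
Variables (R : realType) (n : nat) (w : 'I_n -> 'I_n -> R).
Hypotheses (n_gt1 : (1 < n)%N) (hw : is_weight w).
Local Notation p := (trans_prob w).
Local Notation max_return k := (\big[Num.max/0]_(i < n) (1 + p (2 ^ k) i i)).

Let n_gt0 : (0 < n)%N := ltnW n_gt1.

Lemma max_return_attained k : exists x, max_return k = 1 + p (2 ^ k) x x.
Proof.
eexists; apply: (bigmax_eq_arg _ (Ordinal n_gt0)) => // i _.
by rewrite addr_ge0 // trans_prob_ge0.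
Qed.

Lemma max_return_bounds k : 1 <= max_return k <= 2.
Proof.
have [x ->] := max_return_attained k.
by have := trans_prob_ge0 hw (2 ^ k) x x; have := trans_prob_le1 hw (2 ^ k) x x; lra.
Qed.

Lemma delta_prod_ge1 m : 1 <= \prod_(0 <= k < m) max_return k.
Proof.
elim: m => [|m IH]; first by rewrite big_geq.
rewrite big_nat_recr //= -[leLHS]mulr1; have /andP [m1 _] := max_return_bounds m.
by rewrite ler_pM.
Qed.

Lemma delta_ge0 : 0 <= delta w.
Proof.
rewrite /delta; case: asboolP => // _.
by rewrite invr_ge0 (le_trans _ (delta_prod_ge1 _)).
Qed.

Lemma delta_le1 : delta w <= 1.
Proof.
rewrite /delta; case: asboolP => // _; rewrite invf_le1 ?delta_prod_ge1 //.
by rewrite (lt_le_trans _ (delta_prod_ge1 _)).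
Qed.

Lemma dmix_gt0 d : dmix w = Some d -> (0 < d)%N.
Proof.
case: (dmixP w) => // d' md _ [<-]; case: d' md => // m0.
by case/negP: (not_mixed0 n_gt0 hw n_gt1).
Qed.

(** Each factor of 1/delta is at most 2, and there are floor(log2 dmix) + 1 of them. *)
Lemma delta_ge_inv_dmix : inv_dmix w / 2 <= delta w.
Proof.
rewrite /inv_dmix; case E : (dmix w) => [d|]; last by rewrite mul0r delta_ge0.
have d0 := dmix_gt0 E.
have d1 : 1 <= d%:R :> R by rewrite ler1n.
rewrite /delta; case: asboolP => _; last first.
  by rewrite -invfM invf_le1; lra.
rewrite E -invfM lef_pV2 ?posrE ?(lt_le_trans _ (delta_prod_ge1 _)) ?mulr_gt0 ?ltr0n //=.
apply: (@le_trans _ _ (2 ^+ (trunc_log 2 d).+1)).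
  elim: (trunc_log 2 d).+1 => [|m IH]; first by rewrite big_geq.
  rewrite big_nat_recr //= exprSr; have /andP [m1 m2] := max_return_bounds m.
  by rewrite ler_pM ?(le_trans _ (delta_prod_ge1 _)) ?(le_trans _ m1).
by rewrite exprSr -natrX ler_pM2r // ler_nat trunc_logP.
Qed.

(** p_(2^(k+1))(x,x) is pi(x) times the return ratio at 2^k, so [prod_decay] applies with constant
    80 b. If [w] is not connected, delta = 1. *)
Lemma delta_ge_escape T b : 1 <= T -> 1 <= b ->
    (connected w -> escape_bound w T) -> (forall x, stationary w x ^+ 2 * T <= b) ->
  (256 * (80 * b))^-1 <= delta w.
Proof.
move=> T1 b1 esc pib; rewrite /delta; case: asboolP => [/esc esc'|_]; last first.
  by rewrite invf_le1; lra.
have [d E _] := dmix_le n_gt0 hw T1 esc'.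
rewrite E /= lef_pV2 ?posrE ?(lt_le_trans _ (delta_prod_ge1 _)) //; last by lra.
rewrite (eq_bigr (fun k => 1 + (max_return k - 1))); last by move=> k _; rewrite addrC subrK.
apply: prod_decay; first by lra.
  by move=> k; have := max_return_bounds k; lra.
(* Exponents start at 1 because return ratios live at even times 2 * 2^k. *)
case=> // k /andP [_ kd]; have [x ->] := max_return_attained k.+1.
have d0 := dmix_gt0 E.
have kd' : (0 < 2 ^ k.+1 <= d)%N.
  by rewrite expn_gt0 /= (leq_trans _ (trunc_logP (isT : (1 < 2)%N) d0)) // leq_exp2l.
have U := return_ratio_le n_gt0 hw T1 esc' x E kd'.
have -> : 1 + p (2 ^ k.+1) x x - 1 = stationary w x * return_ratio w x (2 ^ k).
  rewrite addrAC subrr add0r /return_ratio addnn -mul2n -expnS mulrCA divff ?mulr1 //.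
  by rewrite gt_eqF // stationary_gt0.
have pi2 := sqr_ge0 (stationary w x).
rewrite exprMn -mulrA; apply: (le_trans (ler_wpM2l pi2 U)).
by rewrite mulrCA ler_pM2l.
Qed.

End DeltaBounds.

(** * Graph distance and geodesics *)

Section Geodesic.
Variables (V : finType) (e : rel V) (x : V).
Hypothesis e_connected : forall z, connect e x z.

Fixpoint graph_ball k : {set V} :=
  if k is m.+1 then graph_ball m :|: [set z | [exists y in graph_ball m, e y z]]
  else [set x].

Lemma graph_ball_sub k m : (k <= m)%N -> graph_ball k \subset graph_ball m.
Proof.
move=> /subnK <-; elim: (m - k)%N => //= d IH.
exact: subset_trans IH (subsetUl _ _).
Qed.

Lemma graph_ball_step k y z : y \in graph_ball k -> e y z -> z \in graph_ball k.+1.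
Proof.
move=> yk eyz; rewrite !inE; apply/orP; right.
by apply/existsP; exists y; rewrite yk.
Qed.

Lemma graph_ball_cover z : exists k, z \in graph_ball k.
Proof.
have /connectP [q + ->] := e_connected z; elim/last_ind: q => [|q y IH] /=.
  by exists 0%N; rewrite inE.
rewrite rcons_path last_rcons => /andP [/IH [k qk] ey].
by exists k.+1; apply: graph_ball_step qk ey.
Qed.

Definition graph_dist z : nat := ex_minn (graph_ball_cover z).

Lemma graph_dist_leq z k : (graph_dist z <= k)%N = (z \in graph_ball k).
Proof.
rewrite /graph_dist; case: ex_minnP => d zd dmin; apply/idP/idP => [dk|]; last exact: dmin.
exact: (subsetP (graph_ball_sub dk)).
Qed.

Lemma graph_dist0 z : (graph_dist z == 0)%N = (z == x).
Proof. by rewrite -leqn0 graph_dist_leq inE. Qed.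

Lemma graph_dist_lip y z : e y z -> (graph_dist z <= (graph_dist y).+1)%N.
Proof. by rewrite graph_dist_leq; apply: graph_ball_step; rewrite -graph_dist_leq. Qed.

Lemma graph_dist_pred z k : graph_dist z = k.+1 -> exists2 y, e y z & graph_dist y = k.
Proof.
move=> zk; have : z \in graph_ball k.+1 by rewrite -graph_dist_leq zk.
rewrite !inE -graph_dist_leq zk ltnn /= => /existsP [y /andP [yk eyz]].
exists y => //; apply/eqP; rewrite eqn_leq graph_dist_leq yk /=.
by have := graph_dist_lip eyz; rewrite zk ltnS.
Qed.

Lemma geodesic_to z k : graph_dist z = k -> exists v : nat -> V,
  [/\ v 0%N = x, v k = z, forall i, (i <= k)%N -> graph_dist (v i) = i
    & forall i, (i < k)%N -> e (v i) (v i.+1)].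
Proof.
elim: k z => [|k IH] z zk.
  exists (fun=> z); split=> //; first by apply/eqP; rewrite -graph_dist0 zk.
  by case.
have [y eyz yk] := graph_dist_pred zk; have [v [v0 vk vd ve]] := IH y yk.
exists (fun i => if (i <= k)%N then v i else z); split=> //.
- by rewrite ltnn.
- by move=> i ik; case: ifP => [/vd//|/negbT]; rewrite -ltnNge => ki; rewrite zk; lia.
move=> i; rewrite ltnS => ik; rewrite ik.
case: ltnP => [/ve//|ki]; have -> : i = k by apply/eqP; rewrite eqn_leq ik.
by rewrite vk.
Qed.

(** The path leads to a point outside [A] nearest to [x], so every closer point lies in [A]. *)
Lemma geodesic_exit (A : {pred V}) : x \in A -> (exists y, y \notin A) ->
  exists l (v : nat -> V),
    [/\ v 0%N = x, v l.+1 \notin A,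
        forall i, (i <= l.+1)%N -> graph_dist (v i) = i,
        forall i, (i < l.+1)%N -> e (v i) (v i.+1)
      & forall z, (graph_dist z <= l)%N -> z \in A].
Proof.
move=> xA [y0 y0A]; case: (@arg_minnP _ y0 (fun y => y \notin A) graph_dist y0A) => y yA ymin.
have : (0 < graph_dist y)%N by rewrite lt0n graph_dist0; apply: contraNneq yA => ->.
case E : (graph_dist y) => [//|l] _; have [v [v0 vl vd ve]] := geodesic_to E.
exists l, v; split=> //; first by rewrite vl.
move=> z zl; apply/negPn/negP => /ymin; rewrite E => lz.
by have := leq_trans lz zl; rewrite ltnn.
Qed.

End Geodesic.

Lemma sum_injective_le (R : numDomainType) (I J : finType) (v : I -> J) (F : J -> R) :
  injective v -> (forall j, 0 <= F j) -> \sum_i F (v i) <= \sum_j F j.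
Proof.
move=> vi F0; rewrite -(big_imset (h := v) (A := predT)) /=; last by move=> ? ? _ _ /vi.
by rewrite [leRHS](bigID (mem [set v i | i in predT])) /= lerDl sumr_ge0.
Qed.

(** * Escape bounds along geodesics *)

Section EscapeBounds.
Variables (R : realType) (n : nat) (w : 'I_n -> 'I_n -> R).
Hypotheses (n_gt1 : (1 < n)%N) (hw : is_weight w).
Local Notation deg := (wdeg w).
Local Notation tot := (wtot w).
Local Notation pi := (stationary w).

Let n_gt0 : (0 < n)%N := ltnW n_gt1.

Definition weight_edge : rel 'I_n := [rel i j | 0 < w i j].

Lemma connected_connect : connected w -> forall x y, connect weight_edge x y.
Proof.
move=> cw x y; have [t] := cw x y; elim: t y => [|t IH] y.
  by rewrite trans_prob0; case: eqP => [-> _|_]; rewrite ?connect0 ?ltxx.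
rewrite -addn1 trans_probD => sum_gt0.
have [z pz] : exists z, 0 < trans_prob w t x z * trans_prob w 1 z y.
  apply: contrapT => no; move: sum_gt0; rewrite ltNge sumr_le0 // => z _.
  by rewrite leNgt; apply/negP => pz; apply: no; exists z.
have p0 := trans_prob_ge0 hw t x z.
have xz : connect weight_edge x z.
  by apply: IH; rewrite lt0r p0 andbT; apply: contraTneq pz => ->; rewrite mul0r ltxx.
apply: (connect_trans xz); move: pz; rewrite trans_prob1.
case: eqP => [-> _|_]; first exact: connect0.
move=> pz; apply: connect1; rewrite /weight_edge /= lt0r weight_ge0 // andbT.
by apply: contraTneq pz => ->; rewrite mul0r mulr0 ltxx.
Qed.

Variable h : 'I_n -> R.
Local Notation grad2 := (\sum_i \sum_j w i j * (h i - h j) ^+ 2).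

(** Cauchy-Schwarz over the l + 1 increments; injectivity on the starting points ensures that no
    edge term is counted twice. *)
Lemma path_energy (m : R) (l : nat) (v : nat -> 'I_n) : 0 <= m ->
  {in gtn l.+1 &, injective v} ->
  (forall i, (i < l.+1)%N -> m <= w (v i) (v i.+1)) ->
  m * (h (v 0%N) - h (v l.+1)) ^+ 2 <= l.+1%:R * grad2.
Proof.
move=> m0 vi vm.
have -> : h (v 0%N) - h (v l.+1) = \sum_(i < l.+1) 1 * (h (v i) - h (v i.+1)).
  rewrite -opprB -(@telescope_sumr _ 0 l.+1 (fun i => h (v i))) // big_mkord -sumrN.
  by apply: eq_bigr => i _; rewrite mul1r opprB.
have := @weighted_cauchy R 'I_l.+1 (fun=> 1) (fun i => h (v i) - h (v i.+1)) (fun=> ler01).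
rewrite sumr_const card_ord => /(ler_wpM2l m0) cs; apply: (le_trans cs).
rewrite mulrCA ler_wpM2l // mulr_sumr.
pose F a := \sum_b w a b * (h a - h b) ^+ 2.
apply: (@le_trans _ _ (\sum_(i < l.+1) F (v i))).
  apply: ler_sum => i _; rewrite mul1r /F (bigD1 (v i.+1)) //=.
  rewrite (le_trans (ler_wpM2r (sqr_ge0 _) (vm _ (ltn_ord i)))) // lerDl.
  by apply: sumr_ge0 => b _; apply: mulr_ge0; [apply: weight_ge0 | apply: sqr_ge0].
apply: (@sum_injective_le _ _ _ (fun i : 'I_l.+1 => v i)).
  by move=> i j vij; apply/val_inj/vi => //; rewrite inE ltn_ord.
by move=> a; apply: sumr_ge0 => b _; apply: mulr_ge0; [apply: weight_ge0 | apply: sqr_ge0].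
Qed.

(** [geodesic_exit] for the set h > s: a long path costs energy only linearly in its length, and its
    length forces the superlevel set to be large. [D] is the distance from [x]. *)
Lemma geodesic_escape (m : R) x s : connected w -> 0 <= m ->
    (forall i j, 0 < w i j -> m <= w i j) -> s < h x -> (exists y, h y <= s) ->
  exists l (v : nat -> 'I_n) (D : 'I_n -> nat),
    [/\ m * (h x - s) ^+ 2 <= l.+1%:R * grad2,
        forall i, (i <= l)%N -> D (v i) = i,
        forall i, (i <= l)%N -> 0 < w (v i) (v i.+1),
        forall a b, 0 < w a b -> (D b <= (D a).+1)%N
      & forall z, (D z <= l)%N -> s < h z].
Proof.
move=> cw m0 mw sx [y ys].
have yA : y \notin [pred a | s < h a] by rewrite inE -leNgt.
have [l [v [v0 vl vD ve DA]]] :=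
  geodesic_exit (connected_connect cw x) (sx : x \in [pred a | s < h a]) (ex_intro _ y yA).
exists l, v, (graph_dist (connected_connect cw x)); split=> //.
- have vl' : h (v l.+1) <= s by rewrite leNgt.
  apply: le_trans (_ : m * (h (v 0%N) - h (v l.+1)) ^+ 2 <= _).
    by rewrite v0 ler_wpM2l // ler_sqr ?nnegrE; lra.
  apply: path_energy => // [i j il jl vij|i il]; last exact: mw (ve i il).
  by rewrite -(vD i (ltnW il)) vij (vD j (ltnW jl)).
- by move=> i il; apply: vD; apply: leqW.
- by move=> a b; apply: graph_dist_lip.
Qed.

Lemma sum_path_le (l : nat) (v : nat -> 'I_n) (D : 'I_n -> nat) (F : 'I_n -> R) :
  (forall i, (i <= l)%N -> D (v i) = i) -> (forall a, 0 <= F a) ->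
  \sum_(i < l.+1) F (v i) <= \sum_a F a.
Proof.
move=> vD F0; apply: (@sum_injective_le _ _ _ (fun i : 'I_l.+1 => v i)) => // i j vij.
by apply: val_inj; rewrite /= -(vD i (ltn_ord i)) vij (vD j (ltn_ord j)).
Qed.

Lemma grad2_ge0 : 0 <= grad2.
Proof.
apply: sumr_ge0 => i _; apply: sumr_ge0 => j _.
by apply: mulr_ge0; [apply: weight_ge0 | apply: sqr_ge0].
Qed.

End EscapeBounds.

Section EscapeCases.
Variables (R : realType) (n : nat) (w : 'I_n -> 'I_n -> R).
Hypotheses (n_gt1 : (1 < n)%N) (hw : is_weight w) (cw : connected w).
Local Notation deg := (wdeg w).
Local Notation tot := (wtot w).
Local Notation pi := (stationary w).

Let n_gt0 : (0 < n)%N := ltnW n_gt1.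

Lemma weight_le_wdeg i j : w i j <= deg i.
Proof.
rewrite (wdegE hw) (bigD1 j) //= lerDl.
by apply: sumr_ge0 => k _; apply: weight_ge0.
Qed.

(** The l + 1 path points in the superlevel set have degree at least [m], which bounds l + 1 by its
    total degree over [m]. *)
Lemma escape_min_weight (m : R) : 0 < m -> (forall i j, 0 < w i j -> m <= w i j) ->
  escape_bound w (4 * (tot / m) ^+ 2).
Proof.
move=> m0 mw h x s sx ys.
have [l [v [D [E vD vw _ DA]]]] := geodesic_escape hw cw (ltW m0) mw sx ys.
pose F a := if s < h a then deg a else 0.
have F0 a : 0 <= F a by rewrite /F; case: ifP => // _; apply/ltW/wdeg_gt0.
have lA : m * l.+1%:R <= \sum_(a | s < h a) deg a.
  rewrite [leRHS]big_mkcond; apply: le_trans (sum_path_le vD F0).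
  rewrite mulr_natr -[l.+1 in leLHS]card_ord -sumr_const; apply: ler_sum => i _.
  have il : (i <= l)%N := ltn_ord i.
  rewrite /F DA ?vD //; apply: le_trans (weight_le_wdeg (v i) (v i.+1)).
  exact: mw (vw i il).
have := grad2_ge0 hw h; move: E; rewrite /edge_energy -mulr_suml.
set S := \sum_i _; set A := \sum_(a | _) _ in lA *; set y := (h x - s) ^+ 2 => E S0.
have tot0 := wtot_gt0 n_gt0 hw.
have -> : 4 * (tot / m) ^+ 2 * (A * tot^-1) * ((4 * tot)^-1 * S) = A * S / (m * m).
  by field; rewrite !gt_eqF.
rewrite ler_pdivlMr ?mulr_gt0 //.
have := ler_wpM2l (ltW m0) E; have := ler_wpM2r S0 lA; lra.
Qed.

Lemma count_eq_le1 l c : (\sum_(k < l) (k == c :> nat) <= 1)%N.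
Proof.
suff -> : (\sum_(k < l) (k == c :> nat) = (c < l))%N by case: (c < l)%N.
elim: l => [|l IH]; first by rewrite big_ord0.
by rewrite big_ord_recr /= IH; lia.
Qed.

Lemma count_near_le3 l c : (\sum_(k < l) ((c <= k.+1) && (k <= c.+1)) <= 3)%N.
Proof.
apply: (@leq_trans (\sum_(k < l) ((k == c.-1 :> nat) + (k == c :> nat) + (k == c.+1 :> nat)))).
  by apply: leq_sum => k _; lia.
rewrite !big_split /=.
exact: (leq_add (leq_add (count_eq_le1 l c.-1) (count_eq_le1 l c)) (count_eq_le1 l c.+1)).
Qed.

(** Let [c] be the size of the superlevel set. If d > 2c, over half of the edges at [x] leave it;
    otherwise (l + 1) d <= 3c + 2c = 5c. The 20 is this 5 times the 4 in [edge_energy]. *)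
Lemma escape_regular (d : nat) : (forall i j, w i j = 0 \/ w i j = 1) ->
  (forall i, deg i = d%:R) -> escape_bound w (20 * n%:R ^+ 2).
Proof.
move=> w01 wd h x s sx ys.
have mw i j : 0 < w i j -> 1 <= w i j by case: (w01 i j) => ->; rewrite ?ltxx.
have w_le1 i j : w i j <= 1 by case: (w01 i j) => ->.
have [l [v [D [E vD vw DL DA]]]] := geodesic_escape hw cw ler01 mw sx ys.
have d0 : 0 < d%:R :> R by rewrite -(wd x) wdeg_gt0.
have n0 : 0 < n%:R :> R by rewrite ltr0n.
have totE : tot = n%:R * d%:R.
  by rewrite /wtot (eq_bigr _ (fun i _ => wd i)) sumr_const card_ord mulr_natl.
pose c : R := \sum_(a | s < h a) 1.
have piA : \sum_(a | s < h a) pi a = c / n%:R.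
  rewrite /c mulr_suml; apply: eq_bigr => a _; rewrite /stationary wd totE.
  by field; rewrite !gt_eqF.
have c1 : 1 <= c.
  by rewrite /c (bigD1 x) //= lerDl sumr_ge0.
have S0 := grad2_ge0 hw h; move: E S0; rewrite /edge_energy piA totE mul1r.
(* At least d - c edges at [x] end at a value of at most [s]. *)
have outS : (d%:R - c) * (h x - s) ^+ 2 <= \sum_i \sum_j w i j * (h i - h j) ^+ 2.
  rewrite [leRHS](bigD1 x) //= ler_wpDr //.
    apply: sumr_ge0 => i _; apply: sumr_ge0 => j _.
    by apply: mulr_ge0; [apply: weight_ge0 | apply: sqr_ge0].
  apply: (@le_trans _ _ (\sum_(j | ~~ (s < h j)) w x j * (h x - s) ^+ 2)).
    rewrite -mulr_suml ler_wpM2r ?sqr_ge0 // -(wd x) (wdegE hw).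
    rewrite (bigID (fun j => s < h j)) /= lerBlDl lerD2r.
    by apply: ler_sum => j _.
  rewrite [leRHS](bigID (fun j => s < h j)) /= ler_wpDl //.
    apply: sumr_ge0 => j _.
    by apply: mulr_ge0; [apply: weight_ge0 | apply: sqr_ge0].
  apply: ler_sum => j; rewrite -leNgt => js; rewrite ler_wpM2l ?weight_ge0 //.
  by rewrite ler_sqr ?nnegrE; lra.
(* Double counting: all neighbours of the first [l] path points are in the superlevel set, and each
   point has at most three neighbours among these path points. *)
have ld : l%:R * d%:R <= 3 * c.
  have near k z : 0 < w (v k) z -> (k < l)%N -> ((D z <= k.+1) && (k <= (D z).+1))%N.
    move=> wkz kl; rewrite -[k in (_ <= k.+1)%N](vD k (ltnW kl)) DL //=.
    by rewrite -[k in (k <= _)%N](vD k (ltnW kl)) DL // (weightC hw).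
  apply: (@le_trans _ _ (\sum_(k < l) \sum_(z | s < h z) w (v k) z)).
    rewrite mulr_natl -[l in leLHS]card_ord -sumr_const; apply: ler_sum => k _.
    rewrite -(wd (v k)) (wdegE hw) (bigID (fun z => s < h z)) /= gerDl.
    apply: sumr_le0 => z zA; rewrite leNgt; apply: contra zA => /near /(_ (ltn_ord k)).
    by case/andP=> Dz _; apply: DA; apply: leq_trans Dz (ltn_ord k).
  rewrite exchange_big /= /c mulr_sumr; apply: ler_sum => z _; rewrite mulr1.
  apply: le_trans (_ : (\sum_(k < l) ((D z <= k.+1) && (k <= (D z).+1)))%N%:R <= _); last first.
    by rewrite (ler_nat R _ 3) count_near_le3.
  rewrite natr_sum; apply: ler_sum => k _.
  have [wkz|] := ltP 0 (w (v k) z); first by rewrite near.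
  by move=> wkz; apply: le_trans wkz _; rewrite ler0n.
set S := \sum_i _ in outS *; move: (h x - s) outS => y outS E S0.
have -> : 20 * n%:R ^+ 2 * (c / n%:R) * ((4 * (n%:R * d%:R))^-1 * S) = 5 * c * S / d%:R.
  by field; rewrite !gt_eqF.
rewrite ler_pdivlMr //.
have cS : S <= c * S by rewrite ler_peMl.
have y0 := sqr_ge0 y.
have [dc|cd] := leP d%:R (2 * c); last first.
  have : 0 <= (d%:R - 2 * c) * y ^+ 2 by apply: mulr_ge0 => //; lra.
  lra.
have : y ^+ 2 * d%:R <= l.+1%:R * S * d%:R by rewrite ler_wpM2r // ltW.
have : (l%:R * d%:R) * S <= 3 * c * S by rewrite ler_wpM2r.
have : d%:R * S <= 2 * c * S by rewrite ler_wpM2r.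
rewrite -natr1; lra.
Qed.

End EscapeCases.

(** * Bounds on delta for general weights and for regular graphs *)

Section WeightBounds.
Variables (R : realType) (n : nat) (w : 'I_n -> 'I_n -> R).
Hypotheses (n_gt1 : (1 < n)%N) (hw : is_weight w).

Let n_gt0 : (0 < n)%N := ltnW n_gt1.

Lemma min_pos_weight_le i j : 0 < w i j -> min_pos_weight w <= w i j.
Proof.
move=> wij; apply: (@le_trans _ _ (\big[Num.min/wtot w]_(k < n | 0 < w i k) w i k)).
  exact: bigmin_le_cond.
exact: bigmin_le_cond.
Qed.

Lemma min_pos_weight_gt0 : 0 < min_pos_weight w.
Proof.
have tot0 := wtot_gt0 n_gt0 hw.
by apply: lt_bigmin => // i _; apply: lt_bigmin.
Qed.

Lemma wdeg_le_max i : wdeg w i <= max_wdeg w.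
Proof. exact: le_bigmax. Qed.

Lemma min_pos_weight_le_wdeg i : min_pos_weight w <= wdeg w i.
Proof.
have [j wij] : exists j, 0 < w i j.
  apply: contrapT => no; have := wdeg_gt0 hw i.
  rewrite (wdegE hw) ltNge sumr_le0 // => j _.
  by rewrite leNgt; apply/negP => wij; apply: no; exists j.
exact: le_trans (min_pos_weight_le wij) (weight_le_wdeg hw i j).
Qed.

Lemma wdeg_le_wtot i : wdeg w i <= wtot w.
Proof.
by rewrite /wtot (bigD1 i) //= lerDl sumr_ge0 // => j _; apply/ltW/wdeg_gt0.
Qed.

(** With T = 4 (tot/m)^2 the total weight cancels: pi(x)^2 T = 4 (w_x/m)^2. *)
Lemma delta_ge_weight_ratio :
  (256 * (80 * 4))^-1 * (min_pos_weight w / max_wdeg w) ^+ 2 <= delta w.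
Proof.
have m0 := min_pos_weight_gt0; set m := min_pos_weight w in m0 *.
pose i0 := Ordinal n_gt0.
have mM : m <= max_wdeg w := le_trans (min_pos_weight_le_wdeg i0) (wdeg_le_max i0).
have mt : m <= wtot w := le_trans (min_pos_weight_le_wdeg i0) (wdeg_le_wtot i0).
have tot0 := wtot_gt0 n_gt0 hw.
have M0 : 0 < max_wdeg w := lt_le_trans m0 mM.
have ratio_ge1 y : m <= y -> 1 <= 4 * (y / m) ^+ 2.
  move=> my; have : 1 <= y / m by rewrite ler_pdivlMr // mul1r.
  move: (y / m) => r r1; have : 1 <= r ^+ 2 by rewrite expr_ge1 //; lra.
  lra.
rewrite [leLHS](_ : _ = (256 * (80 * (4 * (max_wdeg w / m) ^+ 2)))^-1); last first.
  by field; rewrite !gt_eqF.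
apply: (delta_ge_escape n_gt1 hw (ratio_ge1 _ mt) (ratio_ge1 _ mM)) => [cw|x].
  exact: (escape_min_weight n_gt1 hw cw m0 min_pos_weight_le).
have -> : stationary w x ^+ 2 * (4 * (wtot w / m) ^+ 2) = 4 * (wdeg w x / m) ^+ 2.
  by rewrite /stationary; field; rewrite !gt_eqF.
rewrite ler_pM2l // ler_sqr ?nnegrE ?divr_ge0 ?(ltW m0) ?(ltW M0) ?(ltW (wdeg_gt0 hw x)) //.
by rewrite ler_pM2r ?invr_gt0 // wdeg_le_max.
Qed.

(** Here pi = 1/n, so T = 20 n^2 gives pi^2 T = 20. *)
Lemma delta_ge_regular : from_regular_graph w -> (256 * (80 * 20))^-1 <= delta w.
Proof.
case=> e [_ _ [d ed] wE].
have wd i : wdeg w i = d%:R.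
  rewrite (wdegE hw) -(ed i) -sum1_card natr_sum [RHS]big_mkcond.
  by apply: eq_bigr => j _; rewrite wE inE; case: (e i j).
have d0 : 0 < d%:R :> R by rewrite -(wd (Ordinal n_gt0)) wdeg_gt0.
have n0 : 1 <= n%:R :> R by rewrite ler1n.
have n2 : 1 <= n%:R ^+ 2 :> R by rewrite expr_ge1 //; lra.
apply: (@delta_ge_escape _ _ _ n_gt1 hw (20 * n%:R ^+ 2)); [lra | lra | | ].
  move=> cw; apply: (escape_regular n_gt1 hw cw _ wd) => i j.
  by rewrite wE; case: (e i j); [right | left].
move=> x; have totE : wtot w = n%:R * d%:R.
  by rewrite /wtot (eq_bigr _ (fun i _ => wd i)) sumr_const card_ord mulr_natl.
rewrite /stationary wd totE le_eqVlt; apply/orP; left; apply/eqP.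
by field; rewrite !gt_eqF //; lra.
Qed.

End WeightBounds.

(** * Assembling the operator inequality and the estimates *)

Lemma sum_ordered_pairs (R : realFieldType) n (g : 'I_n -> 'I_n -> R) :
  (forall i j, g i j = g j i) -> (forall i, g i i = 0) ->
  \sum_i \sum_j g i j = 2 * \sum_(i < n) \sum_(j < n | (i < j)%N) g i j.
Proof.
move=> gC g0; rewrite mulr2n mulrDl mul1r.
transitivity (\sum_(i < n) \sum_(j < n | (i < j)%N) g i j +
              \sum_(i < n) \sum_(j < n | (j < i)%N) g i j).
  rewrite -big_split; apply: eq_bigr => i _ /=.
  rewrite (bigID (fun j : 'I_n => (i < j)%N)) /=; congr (_ + _).
  rewrite (bigD1 i) ?ltnn //= g0 add0r; apply: eq_bigl => j.
  by rewrite -leqNgt ltn_neqAle andbC.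
congr (_ + _); rewrite (exchange_big_dep xpredT) //=.
by apply: eq_bigr => j _; apply: eq_bigr => i _; apply: gC.
Qed.

Lemma scale_Delta_K (R : realType) n (r : R) :
  r%:C%C *: Delta_K R n = Delta (fun _ _ : 'I_n => r).
Proof.
rewrite scaler_sumr; apply: eq_bigr => i _.
by rewrite scaler_sumr.
Qed.

Theorem theorem1 (R : realType) :
  exists2 c : R, 0 < c &
    forall (n : nat) (w : 'I_n -> 'I_n -> R),
      (2 <= n)%N -> is_weight w ->
      [/\ op_ge (ga_act (Delta w))
                (ga_act ((c * delta w * inv_dmix w *
                          (min_wdeg_sq w / wtot w))%:C%C *: Delta_K R n)),
          c * (min_pos_weight w / max_wdeg w) ^+ 2 <= delta w,
          from_regular_graph w -> c <= delta w
        & inv_dmix w / 2 <= delta w].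
Proof.
(* The constant for regular graphs, which is below the one for weight ratios and below 3/4. *)
have c_gt0 : 0 < (256 * (80 * 20))^-1 :> R by rewrite invr_gt0 !mulr_gt0.
exists (256 * (80 * 20))^-1 => // n w n_gt1 hw; have n_gt0 := ltnW n_gt1.
split; last exact: delta_ge_inv_dmix.
- rewrite scale_Delta_K; apply: Delta_ge => F.
  have energyC i j : swap_energy F i j = swap_energy F j i by rewrite /swap_energy tpermC.
  have := comparison n_gt0 hw F n_gt1.
  rewrite (sum_ordered_pairs energyC) ?(@sum_ordered_pairs _ _ (fun i j => w i j * _));
    [ | by move=> i j; rewrite energyC (weightC hw)
      | by move=> i; rewrite swap_energy_diag mulr0 | exact: swap_energy_diag].
  rewrite mulrCA ler_pM2l //; apply: le_trans.
  under eq_bigr => i _ do rewrite -mulr_sumr.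
  rewrite -mulr_sumr ler_wpM2r //.
    by apply: sumr_ge0 => i _; apply: sumr_ge0 => j _; apply: swap_energy_ge0.
  rewrite ler_wpM2r //.
    apply: divr_ge0; last exact: ltW (wtot_gt0 n_gt0 hw).
    apply: le_bigmin => [|i _]; exact: sqr_ge0.
  rewrite ler_wpM2r //.
    by rewrite /inv_dmix; case: (dmix w) => // d; rewrite invr_ge0.
  (* As delta <= 1, the coefficient c delta is at most the 3/4 of [comparison]. *)
  have := delta_le1 n_gt1 hw; have := delta_ge0 n_gt1 hw => d0 d1.
  have c_le : (256 * (80 * 20))^-1 <= 3 / 4 :> R.
    rewrite -[leRHS]invrK lef_pV2 ?posrE; lra.
  by apply: (le_trans _ c_le); rewrite ler_piMr // ltW.
- apply: le_trans (delta_ge_weight_ratio n_gt1 hw); rewrite ler_wpM2r ?sqr_ge0 //.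
  by rewrite lef_pV2 ?posrE; lra.
- exact: delta_ge_regular.
Qed.
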